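(* Let $U,V,W\subset\mathbb{C}$ be non-empty and compact, let $p\in[1,\infty]$, and let $A\in\Psi E_2(U,V,W)$ be invertible on $\ell^p(\mathbb{Z})$. Let $u\in U$, $v\in V$, $w\in W$ be arbitrary. (1) There exist integer sequences $(l_n)_{n\in\mathbb{N}}$, monotonically decreasing with $l_n\to-\infty$, and $(r_n)_{n\in\mathbb{N}}$, monotonically increasing with $r_n\to+\infty$, such that for all $n\in\mathbb{N}$ one has $l_n\le r_n$ and $$|u_i-u|+|v_i-v|+|w_i-w|<\tfrac1n\qquad\text{for all } i\in\{l_n,l_n+1,\dots,l_n+n\}\cup\{r_n-n,\dots,r_n-1,r_n\}.\qquad( * )$$ (2) Put $\Delta:=|v+2\sqrt{uw}|+|v-2\sqrt{uw}|-2(|u|+|w|)$. Then exactly one of the following three cases occurs: case (a): $\Delta>0$; case (b): $\Delta<0$ and $|u|>|w|$; case (c): $\Delta<0$ and $|u|<|w|$. Which of the cases occurs does not depend on the choice of $(u,v,w)\in U\times V\times W$. (3) For any sequences $(l_n)$, $(r_n)$ as in (1), the finite section method with cut-offs at $(l_n)$ and $(r_n)$ is applicable in case (a) to the equation $Ax=b$; in case (b) to the (equivalent) upward-translated equation $S^{-1}Ax=S^{-1}b$; in case (c) to the (equivalent) downward-translated equation $SAx=Sb$ (for every right-hand side $b\in\ell^p(\mathbb{Z})$).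
   Context: $\mathbb{N}=\{1,2,3,\dots\}$. Matrices. $M(U,V,W)$ is the set of all bi-infinite tridiagonal matrices $A=(a_{ij})_{i,j\in\mathbb{Z}}$ with $a_{i,i-1}=u_i\in U$, $a_{ii}=v_i\in V$, $a_{i,i+1}=w_i\in W$ for all $i\in\mathbb{Z}$ and all other entries zero, acting as bounded operators on $\ell^p(\mathbb{Z})$ by matrix-vector multiplication. $S$ denotes the shift $(Sx)(m)=x(m-1)$, $m\in\mathbb{Z}$, on $\ell^p(\mathbb{Z})$. Pseudoergodicity. For an index set $\mathbb{I}\in\{\mathbb{N},\mathbb{Z}\setminus\mathbb{N}\}$ and a metric space $(\mathcal{M},d)$, a sequence $(a_i)_{i\in\mathbb{I}}$ in $\mathcal{M}$ is pseudoergodic if for every $\varepsilon>0$, every $n\in\mathbb{N}$ and every $(b_1,\dots,b_n)\in\mathcal{M}^n$ there is $k\in\mathbb{I}$ with $k+1,\dots,k+n\in\mathbb{I}$ and $d(a_{k+i},b_i)<\varepsilon$ for $i=1,\dots,n$. $A\in\Psi E_2(U,V,W)$ (''bi-pseudoergodic'') means that $A\in M(U,V,W)$ and, with $a_i:=(u_i,v_i,w_i)\in\mathcal{M}:=U\times V\times W\subset\mathbb{C}^3$, both $(a_i)_{i\in\mathbb{N}}$ and $(a_i)_{i\in\mathbb{Z}\setminus\mathbb{N}}$ are pseudoergodic. Finite section method (FSM). Let $X=\ell^p(\mathbb{Z})$. For integers $l\le r$ let $P_{l,r}:X\to X$ be the operator of multiplication by the characteristic function of $\{l,\dots,r\}$,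 with image $X_{l,r}\cong\mathbb{C}^{r-l+1}$. Given integer sequences $l_n\to-\infty$, $r_n\to+\infty$ with $l_n\le r_n$, the FSM with cut-offs at $(l_n)$ and $(r_n)$ is applicable to an equation $Tx=c$ with an invertible bounded operator $T$ on $X$ (for every right-hand side) if for every $c\in X$ the finite systems $P_{l_n,r_n}TP_{l_n,r_n}x_n=P_{l_n,r_n}c$ have a unique solution $x_n\in X_{l_n,r_n}$ for all sufficiently large $n$, and these solutions remain bounded in $n$ and converge componentwise to the solution $x$ of $Tx=c$. *)

(* Defs.v *)
From HB Require Import structures.
From mathcomp Require Export all_boot all_order all_algebra.
From mathcomp Require Export all_classical all_reals all_analysis.
From mathcomp.real_closed Require Export complex.

Set Implicit Arguments.
Unset Strict Implicit.
Unset Printing Implicit Defensive.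

Import Order.TTheory GRing.Theory Num.Theory.
Import numFieldNormedType.Exports.

Local Open Scope classical_set_scope.
Local Open Scope ring_scope.

(* Complex numbers are [R[i]], with real-valued modulus [Normc.normc];
   [R[i]^o] is the same type with the topology of its absolute value. *)

(* The power-set sigma-algebra on [int], so that l^p(Z) can be obtained from
   the counting measure. *)
HB.instance Definition _ := isPointed.Build int 0.
HB.instance Definition _ := @isMeasurable.Build default_measure_display
  int discrete_measurable discrete_measurable0
  discrete_measurableC discrete_measurableU.

Definition lpnorm (R : realType) (p : \bar R) (x : int -> R[i]) : \bar R :=
  Lnorm (@counting int R) p (fun i => (Normc.normc (x i))%:E).

Definition ell (R : realType) (p : \bar R) : set (int -> R[i]) :=
  [set x | (lpnorm p x < +oo)%E].

(* The operators below are total maps on all complex sequences; only their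
   restriction to [ell p] matters. *)

Definition bounded_op (R : realType) (p : \bar R)
    (T : (int -> R[i]) -> (int -> R[i])) : Prop :=
  [/\ (forall x, ell p x -> ell p (T x)),
      (forall (a : R[i]) x y, ell p x -> ell p y ->
         T (fun i => a * x i + y i) = fun i => a * T x i + T y i) &
      exists K : R, forall x, ell p x ->
         (lpnorm p (T x) <= K%:E * lpnorm p x)%E].

Definition invertible_op (R : realType) (p : \bar R)
    (T : (int -> R[i]) -> (int -> R[i])) : Prop :=
  bounded_op p T /\
  exists2 B, bounded_op p B &
    forall x, ell p x -> T (B x) = x /\ B (T x) = x.

(* For a band matrix every row has finite support, so that the finitely
   supported sum is the full matrix-vector product. *)
Definition act (R : realType) (A : int -> int -> R[i]) (x : int -> R[i]) :
    int -> R[i] :=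
  fun i => \sum_(j \in [set: int]) A i j * x j.

Definition shift (R : realType) (x : int -> R[i]) : int -> R[i] :=
  fun m => x (m - 1).

Definition shiftV (R : realType) (x : int -> R[i]) : int -> R[i] :=
  fun m => x (m + 1).

Definition tridiagonal (R : realType) (U V W : set R[i])
    (A : int -> int -> R[i]) : Prop :=
  (forall i, [/\ U (A i (i - 1)), V (A i i) & W (A i (i + 1))]) /\
  (forall i j, 1 < `|i - j| -> A i j = 0).

Definition diags (R : realType) (A : int -> int -> R[i]) (i : int) :
    R[i] * R[i] * R[i] :=
  (A i (i - 1), A i i, A i (i + 1)).

(* Euclidean distance of C^3. *)
Definition dist3 (R : realType) (a b : R[i] * R[i] * R[i]) : R :=
  Num.sqrt (Normc.normc (a.1.1 - b.1.1) ^+ 2 +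
            Normc.normc (a.1.2 - b.1.2) ^+ 2 +
            Normc.normc (a.2 - b.2) ^+ 2).

(* [(M, d)] is the metric space, [I] the index set; only the values of [a] on
   [I] and of [b] at 1, ..., n are relevant. *)
Definition pseudoergodic (R : realType) (T : Type) (M : set T)
    (d : T -> T -> R) (I : set int) (a : int -> T) : Prop :=
  (forall i, I i -> M (a i)) /\
  forall (eps : R) (n : nat) (b : nat -> T),
    0 < eps -> (0 < n)%N -> (forall i, (1 <= i <= n)%N -> M (b i)) ->
    exists2 k : int, I k &
      forall i : nat, (1 <= i <= n)%N ->
        I (k + i%:Z) /\ d (a (k + i%:Z)) (b i) < eps.

(* Since 0 is not in N, the index set Z \ N is {i | i <= 0}. *)
Definition PsiE2 (R : realType) (U V W : set R[i])
    (A : int -> int -> R[i]) : Prop :=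
  [/\ tridiagonal U V W A,
      pseudoergodic (U `*` V `*` W) (@dist3 R) [set i : int | 1 <= i]
        (diags A) &
      pseudoergodic (U `*` V `*` W) (@dist3 R) [set i : int | i <= 0]
        (diags A)].

Definition cutP (R : realType) (l r : int) (x : int -> R[i]) : int -> R[i] :=
  fun i => if l <= i <= r then x i else 0.

Definition finite_section_solution (R : realType)
    (T : (int -> R[i]) -> (int -> R[i])) (l r : int) (c y : int -> R[i]) :
    Prop :=
  range (cutP l r) y /\ cutP l r (T (cutP l r y)) = cutP l r c.

(* Applicability of the finite section method with cut-offs at [l n], [r n] to
   the single equation [T x = c] with invertible [T]. *)
Definition fsm_applicable (R : realType) (p : \bar R)
    (T : (int -> R[i]) -> (int -> R[i])) (c : int -> R[i])
    (l r : nat -> int) : Prop :=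
  [/\ invertible_op p T,
      ell p c &
      exists xs : nat -> int -> R[i],
        [/\ \forall n \near \oo,
              finite_section_solution T (l n) (r n) c (xs n) /\
              (forall y, finite_section_solution T (l n) (r n) c y ->
                 y = xs n),
            exists M : R, \forall n \near \oo, (lpnorm p (xs n) <= M%:E)%E &
            exists x, [/\ ell p x, T x = c &
              forall i, (xs n i : R[i]^o) @[n --> \oo] --> (x i : R[i]^o)]]].

(* Cut-off sequences are indexed by n = 1, 2, ...; the values [l 0] and [r 0]
   play no role. *)
Definition good_cutoffs (R : realType) (A : int -> int -> R[i])
    (u v w : R[i]) (l r : nat -> int) : Prop :=
  [/\ (forall m n : nat, (1 <= m <= n)%N -> l n <= l m),
      (forall K : int, \forall n \near \oo, l n <= K),
      (forall m n : nat, (1 <= m <= n)%N -> r m <= r n),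
      (forall K : int, \forall n \near \oo, K <= r n) &
      forall n : nat, (1 <= n)%N ->
        l n <= r n /\
        forall i : int,
          (l n <= i <= l n + n%:Z) || (r n - n%:Z <= i <= r n) ->
          Normc.normc (A i (i - 1) - u) + Normc.normc (A i i - v)
            + Normc.normc (A i (i + 1) - w) < n%:R^-1].

(* The value does not depend on which square root of [u * w] is chosen. *)
Definition Delta (R : realType) (u v w : R[i]) : R :=
  Normc.normc (v + 2 * sqrtC (u * w)) + Normc.normc (v - 2 * sqrtC (u * w))
    - 2 * (Normc.normc u + Normc.normc w).

Definition case_a (R : realType) (u v w : R[i]) : Prop :=
  0 < Delta u v w.

Definition case_b (R : realType) (u v w : R[i]) : Prop :=
  Delta u v w < 0 /\ Normc.normc w < Normc.normc u.

Definition case_c (R : realType) (u v w : R[i]) : Prop :=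
  Delta u v w < 0 /\ Normc.normc u < Normc.normc w.

(* Main.v *)
From HB Require Import structures.
Require Import Defs.
From mathcomp Require Import ess_sup_inf ring lra zify.

Set Implicit Arguments.
Unset Strict Implicit.
Unset Printing Implicit Defensive.

Import Order.TTheory GRing.Theory Num.Theory.
Import numFieldNormedType.Exports.

Local Open Scope classical_set_scope.
Local Open Scope ring_scope.

(** Factor the symbol as [u + v t + w t^2 = (a t + b) (c t + d)]. By the
    parallelogram law [Delta = 2 (|a| - |b|) (|d| - |c|)], so that the sign of
    [Delta] and the comparison of [|u|] with [|w|] tell how many zeros of the
    symbol lie inside the unit circle.

    If two triples of [U x V x W] had different numbers of zeros inside, or one
    of them had a zero on the circle, then after a small perturbation the
    operator that equals the first Laurent operator on the left half-axis and
    the second one on the right half-axis would have a decaying null vector.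
    By pseudoergodicity a truncation of this vector can be moved to a place
    where [A] looks like that operator, so [A] would not be bounded below.

    For stability, split a vector on [l_n, r_n] by slowly varying cut-offs into
    a left, a middle and a right part; the commutators are small. On the middle
    part the finite section acts as [A]. On the outer parts it is close to
    a triangular or Wiener-Hopf product of two bidiagonal Toeplitz matrices,
    each of which is explicitly bounded below. Cutting off around a fixed index
    gives the componentwise convergence. Of the norm only monotonicity, the
    triangle inequality and the invariance under permutations of the index set
    matter, so that all p are treated simultaneously. *)

(** * The norm of l^p(Z) *)

Section LpNorm.
Variables (R : realType) (p : \bar R).
Hypothesis p1 : (1 <= p)%E.
Local Notation C := R[i].
Local Notation normc := Normc.normc.
Local Notation count := (@counting int R).
Implicit Types (x y : int -> C).

Lemma normc_ge0 (z : C) : 0 <= normc z.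
Proof. by case: z => a b; rewrite sqrtr_ge0. Qed.

Lemma counting_set1 (k : int) : count [set k] = 1%E.
Proof. by rewrite /counting asboolT// fset_set1 finmap.cardfs1. Qed.

Lemma counting_setT_gt0 : (0 < count setT)%E.
Proof.
apply: (@lt_le_trans _ _ (count [set 0])); first by rewrite counting_set1.
by apply: le_measure; rewrite ?inE.
Qed.

(** For [p = +oo] the norm is an essential supremum; since only the empty set is null, it can be
    handled pointwise. *)
Lemma negligible_counting (S : set int) : count S = 0%E -> S = set0.
Proof.
move=> S0; apply/seteqP; split => // k Sk.
have : (count [set k] <= count S)%E by apply: le_measure; rewrite ?inE// => _ ->.
by rewrite S0 counting_set1 lee_fin ler10.
Qed.

Lemma le_lpnorm x y : (forall i, normc (x i) <= normc (y i)) ->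
  (lpnorm p x <= lpnorm p y)%E.
Proof.
move=> xy; rewrite /lpnorm unlock; case: p p1 => [r|_|//].
- rewrite lee_fin => r1.
  have r0 : 0 <= r by lra.
  apply: gt0_ler_poweR.
  + by rewrite invr_ge0.
  + by rewrite in_itv/= leey andbT; apply: integral_ge0 => i _; rewrite lee_fin powR_ge0.
  + by rewrite in_itv/= leey andbT; apply: integral_ge0 => i _; rewrite lee_fin powR_ge0.
  apply: ge0_le_integral => //= i _.
  rewrite lee_fin; apply: ge0_ler_powR => //; rewrite ?nnegrE ?normr_ge0//.
  by rewrite !ger0_norm ?normc_ge0.
- rewrite counting_setT_gt0; apply: le_ess_sup; apply: nearW => i /=.
  by rewrite lee_fin !ger0_norm ?normc_ge0.
Qed.

Lemma lpnorm_normc x y : (forall i, normc (x i) = normc (y i)) ->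
  lpnorm p x = lpnorm p y.
Proof.
by move=> xy; apply/eqP; rewrite eq_le !le_lpnorm// => i; rewrite xy.
Qed.

Lemma lpnormD x y :
  (lpnorm p (fun i => x i + y i)%R <= lpnorm p x + lpnorm p y)%E.
Proof.
apply: (@le_trans _ _ (Lnorm count p
   (EFin \o ((fun i => normc (x i)) \+ (fun i => normc (y i)))))); last first.
  exact: eminkowski.
(* Monotonicity is available for complex sequences, so the sum of the two moduli is written as the
   modulus of one such sequence. *)
pose z i : C := (normc (x i) + normc (y i))%:C%C.
have nz i : normc (z i) = normc (x i) + normc (y i).
  by rewrite /z /= expr0n /= addr0 sqrtr_sqr ger0_norm// addr_ge0 ?normc_ge0.
have -> : EFin \o ((fun i => normc (x i)) \+ (fun i => normc (y i))) =
   (fun i => (normc (z i))%:E) by apply/funext => i; rewrite nz.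
apply: le_lpnorm => i; rewrite nz; exact: le_normcD.
Qed.

Lemma lpnormZ (a : C) x :
  lpnorm p (fun i => a * x i)%R = ((normc a)%:E * lpnorm p x)%E.
Proof.
rewrite /lpnorm unlock; case: p p1 => //= [r|_].
- rewrite lee_fin => r1.
  have r0 : r != 0 by apply/eqP; lra.
  under eq_integral do rewrite Normc.normcM normrM powRM// EFinM.
  rewrite ge0_integralZl_EFin ?powR_ge0//.
  rewrite poweRM ?lee_fin ?powR_ge0//; last first.
    by apply: integral_ge0 => i _; rewrite lee_fin powR_ge0.
  by rewrite poweR_EFin -powRrM mulfV// powRr1// ger0_norm ?normc_ge0.
- rewrite counting_setT_gt0 -ess_supZl ?counting_setT_gt0 ?normc_ge0//.
  apply: eq_ess_sup; apply: nearW => i /=.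
  by rewrite Normc.normcM normrM EFinM [`|normc a|]ger0_norm ?normc_ge0.
Qed.

(** A bijection preserves cardinality, so counting measure is its own image under [f]; for [p = +oo]
    the emptiness of null sets suffices. Shifts and the reflection are the instances needed. *)
Lemma lpnorm_perm (f g : int -> int) x : cancel f g -> cancel g f ->
  lpnorm p (x \o f) = lpnorm p x.
Proof.
move=> fK gK.
have countE S : count (f @^-1` S) = count S.
  have -> : f @^-1` S = g @` S.
    apply/seteqP; split => [i Si|_ [i Si <-]]; last by rewrite /preimage/= gK.
    by exists (f i).
  have SgS : (g @` S #= S)%card by apply: inj_card_eq => i j _ _ /(can_inj gK).
  have finE := eq_finite_set SgS.
  rewrite /counting; case: (asboolP (finite_set (g @` S))) => fgS.
    have fS : finite_set S by rewrite -finE.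
    rewrite asboolT//; congr (_%:R%:E).
    by apply/(fcard_eq fgS fS).
  by rewrite asboolF// -finE.
rewrite /lpnorm unlock; case: p p1 => [r|_|//].
- rewrite lee_fin => r1; apply: (congr1 (fun t => poweR t r^-1)).
  have mf : measurable_fun setT f by [].
  have := @ge0_integral_pushforward _ _ _ _ R f mf count setT
    (fun i => (`|normc (x i)| `^ r)%:E) measurableT (fun _ _ _ => I).
  rewrite preimage_setT => <-; last by move=> i _; rewrite lee_fin powR_ge0.
  by apply: eq_measure_integral => S _ _; exact: countE.
- rewrite counting_setT_gt0 /ess_sup; congr ereal_inf.
  apply/seteqP; split => y [S [mS S0 sub]].
    exists S; split => //.
    have S0' := negligible_counting S0.
    move=> i /= ni; rewrite S0'; apply: ni.
    have : ~ (~` [set i | (`|normc ((x \o f) i)|%:E <= y)%E]) (g i).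
      by move=> /sub; rewrite S0'.
    by move=> /contrapT /=; rewrite gK.
  exists S; split => //.
  have S0' := negligible_counting S0.
  move=> i /= ni; rewrite S0'; apply: ni.
  have : ~ (~` [set i | (`|normc (x i)|%:E <= y)%E]) (f i).
    by move=> /sub; rewrite S0'.
  by move=> /contrapT.
Qed.

Lemma lpnorm_delta (c : C) (k : int) :
  lpnorm p (fun i => if i == k then c else 0) = (normc c)%:E.
Proof.
have -> : (fun i => if i == k then c else 0) =
          (fun i => c * (if i == k then 1 else 0)).
  by apply/funext => i; case: eqP => _; rewrite ?mulr1 ?mulr0.
rewrite lpnormZ; suff -> : lpnorm p (fun i => if i == k then 1 else 0 : C) = 1%E.
  by rewrite mule1.
have nE i : normc (if i == k then 1 else 0 : C) = (i == k)%:R.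
  by case: eqP => _; rewrite ?Normc.normc1 ?Normc.normc0.
rewrite /lpnorm unlock; case: p p1 => //= [r|_].
- rewrite lee_fin => r1.
  have r0 : r != 0 by apply/eqP; lra.
  under eq_integral do rewrite nE.
  rewrite (_ : (\int[_]_ _ _)%E = \int[count]_i (\1_[set k] i)%:E)%E; last first.
    apply: eq_integral => i _; rewrite indicE; case: eqP => [->|ik].
      by rewrite mem_set// normr1 powR1.
    by rewrite memNset// normr0 powR0.
  rewrite integral_indic// setIT (_ : _ [set k] = 1%E) ?poweR_EFin ?powR1//.
  exact: counting_set1.
- rewrite counting_setT_gt0.
  apply/eqP; rewrite eq_le; apply/andP; split.
    by apply/ess_supP; apply: nearW => i /=; rewrite nE lee_fin; case: eqP => _; rewrite ?normr1 ?normr0.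
  rewrite leNgt; apply/negP => lt1.
  have [S [_ S0 sub]] := ess_sup_ge count (abse \o (fun i => (normc (if i == k then 1 else 0 : C))%:E)).
  have : S k.
    apply: sub => /= /le_lt_trans /(_ lt1).
    by rewrite nE eqxx normr1 ltxx.
  by rewrite (negligible_counting S0).
Qed.

End LpNorm.

(** * The norm as a real number, and domination by shifted copies *)

Section RealNorm.
Variables (R : realType) (p : \bar R).
Hypothesis p1 : (1 <= p)%E.
Local Notation C := R[i].
Local Notation normc := Normc.normc.
Implicit Types (x y z f h : int -> C) (l r k s : int).

(** Real values make linear arithmetic available. An infinite norm becomes 0, which is why
    membership in [ell p] is carried along. *)
Definition nrm (x : int -> C) : R := fine (lpnorm p x).

Lemma nrm_ge0 x : 0 <= nrm x.
Proof. by rewrite fine_ge0// Lnorm_ge0. Qed.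

Lemma lpnormE x : ell p x -> lpnorm p x = (nrm x)%:E.
Proof. by move=> xp; rewrite fineK// ge0_fin_numE// Lnorm_ge0. Qed.

Lemma ell_le x y : (forall i, normc (x i) <= normc (y i)) -> ell p y -> ell p x.
Proof. by move=> xy; apply: le_lt_trans; exact: le_lpnorm. Qed.

Lemma nrm_le x y : (forall i, normc (x i) <= normc (y i)) -> ell p y ->
  nrm x <= nrm y.
Proof.
move=> xy yp; have xp := ell_le xy yp.
by rewrite -lee_fin -!lpnormE//; exact: le_lpnorm.
Qed.

Lemma ellD x y : ell p x -> ell p y -> ell p (fun i => x i + y i).
Proof.
move=> xp yp; apply: le_lt_trans (lpnormD _ _ _) _ => //.
by rewrite !lpnormE// -EFinD ltry.
Qed.

Lemma nrmD x y : ell p x -> ell p y ->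
  nrm (fun i => x i + y i) <= nrm x + nrm y.
Proof.
move=> xp yp; rewrite -lee_fin EFinD -!lpnormE//; last exact: ellD.
exact: lpnormD.
Qed.

Lemma ellZ (a : C) x : ell p x -> ell p (fun i => a * x i).
Proof. by move=> xp; rewrite /ell/= lpnormZ// lpnormE// -EFinM ltry. Qed.

Lemma nrmZ (a : C) x : ell p x -> nrm (fun i => a * x i) = normc a * nrm x.
Proof. by move=> xp; rewrite {1}/nrm lpnormZ// lpnormE. Qed.

Lemma ellN x : ell p x -> ell p (fun i => - x i).
Proof. by apply: ell_le => i; rewrite normcN. Qed.

Lemma nrmN x : nrm (fun i => - x i) = nrm x.
Proof.
by congr fine; apply: lpnorm_normc => // i; rewrite normcN.
Qed.

Lemma nrmB x y : ell p x -> ell p y ->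
  nrm (fun i => x i - y i) <= nrm x + nrm y.
Proof.
move=> xp yp; apply: le_trans (nrmD xp (ellN yp)) _; by rewrite nrmN.
Qed.

Lemma lpnorm_shift x s : lpnorm p (fun i => x (i + s)) = lpnorm p x.
Proof.
apply: (@lpnorm_perm _ _ p1 (fun i => i + s) (fun i => i - s)) => i.
  exact: addrK.
exact: subrK.
Qed.

Lemma lpnorm_opp x : lpnorm p (fun i => x (- i)) = lpnorm p x.
Proof. by apply: (@lpnorm_perm _ _ p1 -%R -%R); exact: opprK. Qed.

Lemma ell_shift x s : ell p x -> ell p (fun i => x (i + s)).
Proof. by rewrite /ell/= lpnorm_shift. Qed.

Lemma nrm_shift x s : nrm (fun i => x (i + s)) = nrm x.
Proof. by rewrite /nrm lpnorm_shift. Qed.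

Lemma ell_opp x : ell p x -> ell p (fun i => x (- i)).
Proof. by rewrite /ell/= lpnorm_opp. Qed.

Lemma nrm_opp x : nrm (fun i => x (- i)) = nrm x.
Proof. by rewrite /nrm lpnorm_opp. Qed.

Lemma ell_delta (c : C) k : ell p (fun i => if i == k then c else 0).
Proof. by rewrite /ell/= lpnorm_delta// ltry. Qed.

Lemma nrm_delta (c : C) k : nrm (fun i => if i == k then c else 0) = normc c.
Proof. by rewrite /nrm lpnorm_delta. Qed.

Lemma normc_le_nrm x k : ell p x -> normc (x k) <= nrm x.
Proof.
move=> xp; rewrite -(nrm_delta (x k) k); apply: nrm_le => // i.
by case: eqP => [->//|_]; rewrite Normc.normc0 normc_ge0.
Qed.

Definition supported l r x := forall i, ~~ (l <= i <= r) -> x i = 0.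

(** Induction on the length of the window: the entry at [r] is split off as a multiple of a unit
    vector. *)
Lemma ell_supported l r x : supported l r x -> ell p x.
Proof.
have [n] := ubnP (absz (r - l + 1)); elim: n r x => // n IHn r x.
have [lr|rl] := leP l r => len sx; last first.
  apply: ell_le (ell_delta 0 0) => i; rewrite sx ?Normc.normc0 ?normc_ge0//.
  by apply/negP => /andP[? ?]; lia.
have -> : x = fun i => (if i == r then x r else 0) +
                       (if i == r then 0 else x i).
  by apply/funext => i; case: eqP => [->|_]; rewrite ?addr0 ?add0r.
apply: ellD; first exact: ell_delta.
have [lr1|rl1] := leP l (r - 1); last first.
  apply: ell_le (ell_delta 0 0) => i; case: eqP => ir.
    by rewrite Normc.normc0 normc_ge0.
  rewrite sx ?Normc.normc0 ?normc_ge0//.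
  by apply/negP => /andP[? ?]; lia.
apply: (IHn (r - 1)) => [|i ni]; first lia.
by case: eqP => // ir; apply: sx; apply: contraNN ni; lia.
Qed.

Lemma nrm_eq0 x : ell p x -> nrm x <= 0 -> x = fun=> 0.
Proof.
move=> xp x0; apply/funext => i; apply: Normc.eq0_normc.
have := normc_le_nrm i xp; have := normc_ge0 (x i); lra.
Qed.

Lemma nrm_dom (K : R) x y s : 0 <= K ->
  (forall i, normc (y i) <= K * normc (x (i + s))) -> ell p x ->
  ell p y /\ nrm y <= K * nrm x.
Proof.
move=> K0 yx xp.
have KC : normc (K%:C%C : C) = K.
  by rewrite /= expr0n /= addr0 sqrtr_sqr ger0_norm.
have yx' i : normc (y i) <= normc (K%:C%C * x (i + s)) by rewrite Normc.normcM KC.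
have xs := ell_shift s xp.
split; first exact: (ell_le yx' (ellZ _ xs)).
by apply: le_trans (nrm_le yx' (ellZ _ xs)) _; rewrite nrmZ// KC nrm_shift.
Qed.

(** A row of a tridiagonal matrix sees three neighbouring entries; the three shifted copies of [x]
    have the same norm, whence the factor 3. *)
Lemma nrm_dom3 (K : R) x y s : 0 <= K ->
  (forall i, normc (y i) <= K * (normc (x (i + s - 1)) + normc (x (i + s)) +
                               normc (x (i + s + 1)))) -> ell p x ->
  ell p y /\ nrm y <= 3 * K * nrm x.
Proof.
move=> K0 yx xp.
pose xa i : C := (normc (x i))%:C%C.
have normC (a : R) : 0 <= a -> normc (a%:C%C : C) = a.
  by move=> a0; rewrite /= expr0n /= addr0 sqrtr_sqr ger0_norm.
have xaE i : normc (xa i) = normc (x i) by rewrite normC ?normc_ge0.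
have xap : ell p xa by apply: ell_le xp => i; rewrite xaE.
have nxa : nrm xa = nrm x by congr fine; apply: lpnorm_normc.
pose z i := K%:C%C * (xa (i + (s - 1)) + xa (i + s) + xa (i + (s + 1))).
have yz i : normc (y i) <= normc (z i).
  rewrite /z Normc.normcM (normC _ K0) /xa -!rmorphD normC ?addr_ge0 ?normc_ge0//.
  by rewrite !addrA.
have e1 := ell_shift (s - 1) xap; have e2 := ell_shift s xap.
have e3 := ell_shift (s + 1) xap.
have zp : ell p z by apply: ellZ; apply: ellD => //; exact: ellD.
split; first exact: ell_le zp.
apply: le_trans (nrm_le yz zp) _.
rewrite /z nrmZ ?normC//; last by apply: ellD => //; exact: ellD.
rewrite [3 * K]mulrC -mulrA ler_wpM2l//.
apply: le_trans (nrmD (ellD e1 e2) e3) _.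
have := nrmD e1 e2; rewrite !nrm_shift nxa; lra.
Qed.

End RealNorm.

(** * Corners of tridiagonal operators *)

Section Corners.
Variables (R : realType) (p : \bar R).
Hypothesis p1 : (1 <= p)%E.
Local Notation C := R[i].
Local Notation normc := Normc.normc.
Local Notation nrm := (nrm p).
Implicit Types (x y z f h al be ga : int -> C) (l r k s : int).

(* The rows of the tridiagonal operator with diagonals [al], [be], [ga],
   shifted by [s]; the cases [s = 1] and [s = -1] are [S^-1 A] and [S A]. *)
Definition tri al be ga s x : int -> C := fun i =>
  al (i + s) * x (i + s - 1) + be (i + s) * x (i + s) +
  ga (i + s) * x (i + s + 1).

Definition halfcut l x : int -> C := fun i => if l <= i then x i else 0.

Lemma halfcut_le l x i : normc (halfcut l x i) <= normc (x i).
Proof.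
by rewrite /halfcut; case: ifP => // _; rewrite Normc.normc0 normc_ge0.
Qed.

Lemma ell_halfcut l x : ell p x -> ell p (halfcut l x).
Proof. by apply: ell_le => // i; exact: halfcut_le. Qed.

(** The triangle inequality in [a z = f - b h], where [h] is a shifted and possibly truncated copy
    of [z] and thus no longer than [z]. Full and compressed bidiagonal matrices are covered at
    once. *)
Lemma bidiagonal_below (a b : C) z h f s : ell p z -> ell p f ->
  (forall i, normc (h i) <= normc (z (i + s))) ->
  (forall i, a * z i = f i - b * h i) ->
  (normc a - normc b) * nrm z <= nrm f.
Proof.
move=> zp fp hz zE.
have [hp nh] : ell p h /\ nrm h <= 1 * nrm z.
  by apply: (nrm_dom p1 (s := s)) => // i; rewrite mul1r.
have : nrm (fun i => a * z i) = nrm (fun i => f i - b * h i).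
  by congr nrm; apply/funext.
rewrite nrmZ// => e.
have := nrmB p1 fp (ellZ p1 b hp); rewrite -e nrmZ//.
have := normc_ge0 b; nra.
Qed.

(** * Semi-infinite Toeplitz matrices with symbol [(a t + b) (c t + d)] *)

Section Toeplitz.
Variables a b c d : C.
Let u := b * d.
Let v := a * d + b * c.
Let w := a * c.

Let L s := tri (fun=> u) (fun=> v) (fun=> w) s.

Lemma ell_L s x : ell p x -> ell p (L s x).
Proof.
move=> xp; have xs := ell_shift p1 s xp.
have xl : ell p (fun i => x (i + s - 1)).
  by apply: ell_le (ell_shift p1 (s - 1) xp) => // i; rewrite addrA.
have xr : ell p (fun i => x (i + s + 1)).
  by apply: ell_le (ell_shift p1 (s + 1) xp) => // i; rewrite addrA.
by apply: ellD => //; [apply: ellD => //|]; exact: ellZ.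
Qed.

(** Wiener-Hopf order: the lower triangular factor [a, b] is applied first and keeps the support in
    the half-line; the upper triangular factor [d, c] then acts compressed to it, so that
    [z (i + 1)] has to be truncated. *)
Lemma toeplitz_below0 l y : ell p y -> (forall i, i < l -> y i = 0) ->
  normc b <= normc a -> normc c <= normc d ->
  (normc a - normc b) * (normc d - normc c) * nrm y <=
  nrm (halfcut l (L 0 y)).
Proof.
move=> yp y0 ba cd.
pose z i := a * y i + b * y (i - 1).
have zp : ell p z by apply: ellD => //; apply: ellZ => //; exact: (ell_shift p1 (-1)).
have n1 : (normc a - normc b) * nrm y <= nrm z.
  apply: (@bidiagonal_below a b y (fun i => y (i - 1)) z (-1)) => // i.
  by rewrite /z; ring.
have n2 : (normc d - normc c) * nrm z <= nrm (halfcut l (L 0 y)).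
  apply: (@bidiagonal_below d c z (halfcut l (fun i => z (i + 1))) _ 1) => //.
  - by apply: ell_halfcut; exact: ell_L.
  - by move=> i; exact: halfcut_le.
  move=> i; rewrite /halfcut /L /tri /z /u /v /w; case: (leP l i) => li.
    by rewrite !addr0 addrK; ring.
  by rewrite !y0; [ring|lia|lia].
by apply: le_trans n2; rewrite -mulrA mulrCA ler_wpM2l// subr_ge0.
Qed.

(** After the upward shift both factors are upper triangular, so the compression of the product is
    the product of the compressions. The diagonal entry is [b * d]. *)
Lemma toeplitz_below_up l y : ell p y -> (forall i, i < l -> y i = 0) ->
  normc a <= normc b -> normc c <= normc d ->
  (normc b - normc a) * (normc d - normc c) * nrm y <=
  nrm (halfcut l (L 1 y)).
Proof.
move=> yp y0 ab cd.
pose z := halfcut l (fun i => d * y i + c * y (i + 1)).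
have zp : ell p z.
  apply: ell_halfcut; apply: ellD => //; apply: ellZ => //.
  exact: (ell_shift p1 1).
have n1 : (normc d - normc c) * nrm y <= nrm z.
  apply: (@bidiagonal_below d c y (halfcut l (fun i => y (i + 1))) z 1) => //.
    by move=> i; exact: halfcut_le.
  move=> i; rewrite /z /halfcut; case: (leP l i) => li; first by ring.
  by rewrite y0; [ring|lia].
have n2 : (normc b - normc a) * nrm z <= nrm (halfcut l (L 1 y)).
  apply: (@bidiagonal_below b a z (halfcut l (fun i => z (i + 1))) _ 1) => //.
  - by apply: ell_halfcut; exact: ell_L.
  - by move=> i; exact: halfcut_le.
  move=> i; rewrite /halfcut /L /tri /z /u /v /w /halfcut; case: (leP l i) => li.
    by rewrite (_ : l <= i + 1) ?addrK; [ring|lia].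
  by rewrite !mulr0 subr0.
by apply: le_trans n2; rewrite -mulrA ler_wpM2l// subr_ge0.
Qed.

(* The first row of the corner is left out: it is not controlled by the
   cut-off condition. *)
Lemma toeplitz_below_down l y : ell p y -> (forall i, i < l -> y i = 0) ->
  normc b <= normc a -> normc d <= normc c ->
  (normc a - normc b) * (normc c - normc d) * nrm y <=
  normc w * normc (y l) + nrm (halfcut (l + 1) (L (-1) y)).
Proof.
move=> yp y0 ba dc.
pose z i := c * y i + d * y (i - 1).
have zp : ell p z by apply: ellD => //; apply: ellZ => //; exact: (ell_shift p1 (-1)).
have n1 : (normc c - normc d) * nrm y <= nrm z.
  apply: (@bidiagonal_below c d y (fun i => y (i - 1)) z (-1)) => // i.
  by rewrite /z; ring.
(* Both factors are now lower triangular, and row [l] of the product is just [w * y l]; it is listed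
   apart from the rows beyond [l]. *)
pose f i := (if i == l then w * y l else 0) + halfcut (l + 1) (L (-1) y) i.
have Lp : ell p (halfcut (l + 1) (L (-1) y)).
  by apply: ell_halfcut; exact: ell_L.
have dp := ell_delta p1 (w * y l) l.
have n2 : (normc a - normc b) * nrm z <= nrm f.
  apply: (@bidiagonal_below a b z (halfcut (l + 1) (fun i => z (i - 1))) _ (-1)) => //.
  - exact: ellD.
  - by move=> i; exact: halfcut_le.
  move=> i; rewrite /f /halfcut /L /tri /z /u /v /w.
  case: eqP => [->|il].
    by rewrite (_ : l + 1 <= l = false) ?(y0 (l - 1)); [ring|lia|lia].
  case: (leP (l + 1) i) => li; first by rewrite subrK; ring.
  by rewrite !y0; [ring|lia|lia].
have n3 := nrmD p1 dp Lp.
rewrite nrm_delta// Normc.normcM in n3.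
apply: le_trans n3; apply: le_trans n2.
by rewrite -mulrA ler_wpM2l// subr_ge0.
Qed.

End Toeplitz.
End Corners.

(** Distance two is the farthest that a row of [tri] reaches when its shift is at most one. *)
Lemma lipschitz2 (R : realType) (phi : int -> R) (e : R) :
  (forall i, `|phi (i + 1) - phi i| <= e) ->
  forall i t, `|t| <= 2 -> `|phi (i + t) - phi i| <= 2 * e.
Proof.
move=> lip i t t2.
have e0 : 0 <= e by apply: le_trans (lip 0).
have h1 j : `|phi j - phi (j + 1)| <= e by rewrite distrC.
have : [\/ t = 0, t = 1, t = 2 | (t = -1) \/ (t = -2)].
  have [?|?] := eqVneq t 0; first by constructor 1.
  have [?|?] := eqVneq t 1; first by constructor 2.
  have [?|?] := eqVneq t 2; first by constructor 3.
  by constructor 4; lia.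
case=> [->|->|->|[->|->]].
- by rewrite addr0 subrr normr0; lra.
- by apply: le_trans (lip i) _; lra.
- have := ler_distD (phi (i + 1)) (phi (i + 2)) (phi i).
  have := lip (i + 1); rewrite -addrA => ? ?; have := lip i; lra.
- by have := h1 (i - 1); rewrite subrK; lra.
- have := ler_distD (phi (i - 1)) (phi (i - 2)) (phi i).
  have := h1 (i - 1); rewrite subrK; have := h1 (i - 2).
  rewrite (_ : i - 2 + 1 = i - 1); [lra|lia].
Qed.

(** * Perturbed corners and commutators with slowly varying cut-offs *)

Section Stability.
Variables (R : realType) (p : \bar R).
Hypothesis p1 : (1 <= p)%E.
Local Notation C := R[i].
Local Notation normc := Normc.normc.
Local Notation nrm := (nrm p).
Implicit Types (x y z f h al be ga : int -> C) (l r k s : int) (u v w : C).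

Definition close al be ga u v w (e : R) (i : int) : Prop :=
  normc (al i - u) + normc (be i - v) + normc (ga i - w) <= e.

(** Coefficients are controlled up to one index past the support of [y], where the last row meeting
    it lies. Right corners are expressed through the reflected operator: outer diagonals exchanged,
    shift negated. *)
Definition left_corner al be ga s u v w (kappa : R) : Prop :=
  forall l (e : R) (m : nat) y, 0 <= e ->
    (forall i, l <= i <= l + m%:Z + 1 -> close al be ga u v w e i) ->
    supported l (l + m%:Z) y ->
    kappa * nrm y <= nrm (halfcut l (tri al be ga s y)) + 3 * e * nrm y.

Lemma ell_tri al be ga s (M : R) x :
  (forall i, normc (al i) <= M /\ normc (be i) <= M /\ normc (ga i) <= M) ->
  ell p x -> ell p (tri al be ga s x) /\ nrm (tri al be ga s x) <= 3 * M * nrm x.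
Proof.
move=> bd xp; apply: (nrm_dom3 p1 (s := s)) => // [|i].
  by have := normc_ge0 (al 0); have [+ _] := bd 0; lra.
rewrite /tri; apply: le_trans (le_normcD _ _) _.
apply: le_trans (lerD (le_normcD _ _) (lexx _)) _; rewrite !Normc.normcM !mulrDr.
have [b1 [b2 b3]] := bd (i + s).
by rewrite !lerD// ler_wpM2r// normc_ge0.
Qed.

Lemma supported_ell_tri al be ga s l r x : `|s| <= 1 -> supported l r x ->
  supported (l - 2) (r + 2) (tri al be ga s x).
Proof.
move=> s1 sx i ni; rewrite /tri !sx ?mulr0 ?addr0//; apply: contraNN ni; clear -s1; lia.
Qed.

Lemma ell_tri_supported al be ga s l r x : `|s| <= 1 -> supported l r x ->
  ell p (tri al be ga s x).
Proof.
by move=> s1 sx; apply: (ell_supported p1 (supported_ell_tri _ _ _ s1 sx)).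
Qed.

(** Every row kept either has coefficients near [u, v, w] or meets only zeros of [y]. The start [l0]
    of the kept rows differs from [l] because for [s = -1] row [l] uses the uncontrolled
    coefficients at [l - 1]. *)
Lemma toeplitz_approx al be ga u v w l l0 (m : nat) s (e : R) y : `|s| <= 1 ->
  0 <= e -> (forall i, l <= i <= l + m%:Z + 1 -> close al be ga u v w e i) ->
  supported l (l + m%:Z) y -> (forall i, l0 <= i -> l <= i + s) ->
  nrm (halfcut l0 (tri (fun=> u) (fun=> v) (fun=> w) s y)) <=
  nrm (halfcut l0 (tri al be ga s y)) + 3 * e * nrm y.
Proof.
move=> s1 e0 cl sy l0s; have yp := ell_supported p1 sy.
pose g := halfcut l0 (fun i => tri al be ga s y i -
                     tri (fun=> u) (fun=> v) (fun=> w) s y i).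
have [gp ng] : ell p g /\ nrm g <= 3 * e * nrm y.
  apply: (nrm_dom3 p1 (s := s)) => // i.
  have N0 := @normc_ge0 R.
  rewrite /g /halfcut; case: (leP l0 i) => li; last first.
    by rewrite Normc.normc0 mulr_ge0// !addr_ge0.
  have [im|im] := leP (i + s) (l + m%:Z + 1).
    have := cl (i + s); rewrite l0s// im /= => /(_ isT); rewrite /close.
    set A := normc (al _ - _); set B := normc (be _ - _).
    set D := normc (ga _ - _) => ABD.
    have [A0 B0 D0] : [/\ 0 <= A, 0 <= B & 0 <= D] by split; exact: N0.
    rewrite (_ : tri al be ga s y i - _ = (al (i + s) - u) * y (i + s - 1) +
      (be (i + s) - v) * y (i + s) + (ga (i + s) - w) * y (i + s + 1)); last first.
      by rewrite /tri; ring.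
    apply: le_trans (le_normcD _ _) _.
    apply: le_trans (lerD (le_normcD _ _) (lexx _)) _.
    rewrite !Normc.normcM !mulrDr -/A -/B -/D.
    by rewrite !lerD// ler_wpM2r//; lra.
  rewrite /tri !(sy (i + s - 1), sy (i + s), sy (i + s + 1)) ?mulr0 ?addr0 ?subr0; try lia.
  by rewrite !Normc.normc0 !addr0 mulr0.
have Tp : ell p (halfcut l0 (tri al be ga s y)).
  by apply: ell_halfcut => //; exact: ell_tri_supported sy.
rewrite (_ : halfcut l0 (tri (fun=> u) (fun=> v) (fun=> w) s y) =
   fun i => halfcut l0 (tri al be ga s y) i - g i); last first.
  apply/funext => i; rewrite /g /halfcut; case: (l0 <= i); last by rewrite subr0.
  by rewrite subKr.
by apply: le_trans (nrmB p1 Tp gp) _; rewrite lerD2l.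
Qed.

Section CornerBounds.
Variables (a b c d : C) (al be ga : int -> C).
Let u := b * d.
Let v := a * d + b * c.
Let w := a * c.

Lemma left_corner0 : normc b < normc a -> normc c < normc d ->
  left_corner al be ga 0 u v w ((normc a - normc b) * (normc d - normc c)).
Proof.
move=> ba cd l e m y e0 cl sy.
apply: (@le_trans _ _ (nrm (halfcut l (tri (fun=> u) (fun=> v) (fun=> w) 0 y)))).
  apply: toeplitz_below0 => //; rewrite ?ltW//; first exact: (ell_supported p1 sy).
  by move=> i il; apply: sy; lia.
by apply: toeplitz_approx cl sy _; rewrite ?normr0// => i; rewrite addr0.
Qed.

Lemma left_corner_up : normc a < normc b -> normc c < normc d ->
  left_corner al be ga 1 u v w ((normc b - normc a) * (normc d - normc c)).
Proof.
move=> ab cd l e m y e0 cl sy.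
apply: (@le_trans _ _ (nrm (halfcut l (tri (fun=> u) (fun=> v) (fun=> w) 1 y)))).
  apply: toeplitz_below_up => //; rewrite ?ltW//; first exact: (ell_supported p1 sy).
  by move=> i il; apply: sy; lia.
by apply: toeplitz_approx cl sy _ => // i; lia.
Qed.

(** The first row of the shifted corner is [ga (l - 1) * y l]. Its coefficient need not be near [w],
    but being bounded away from zero it controls [y l], the one quantity left open by
    [toeplitz_below_down]. *)
Lemma left_corner_down (eta : R) : normc b < normc a -> normc d < normc c ->
  0 < eta -> (forall i, eta <= normc (ga i)) ->
  exists2 kappa, 0 < kappa & left_corner al be ga (-1) u v w kappa.
Proof.
move=> ba dc eta0 gae.
(* The summand 1 pays for the rows beyond [l], and [|w| / eta] for recovering [y l] from row [l]. *)
pose q := 1 + normc w / eta.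
have q1 : 1 <= q by rewrite lerDl divr_ge0 ?normc_ge0// ltW.
have q0 : 0 < q by lra.
exists ((normc a - normc b) * (normc c - normc d) / q).
  by rewrite divr_gt0// mulr_gt0 ?subr_gt0.
move=> l e m y e0 cl sy; have yp := ell_supported p1 sy.
set T := tri al be ga (-1) y.
have Tp : ell p T by exact: (ell_tri_supported _ _ _ _ sy).
have H1 : (normc a - normc b) * (normc c - normc d) * nrm y <=
  normc w * normc (y l) +
  nrm (halfcut (l + 1) (tri (fun=> u) (fun=> v) (fun=> w) (-1) y)).
  apply: toeplitz_below_down => //; rewrite ?ltW//.
  by move=> i il; apply: sy; lia.
have H2 : nrm (halfcut (l + 1) (tri (fun=> u) (fun=> v) (fun=> w) (-1) y)) <=
    nrm (halfcut (l + 1) T) + 3 * e * nrm y.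
  by apply: toeplitz_approx cl sy _ => // i; lia.
have H3 : nrm (halfcut (l + 1) T) <= nrm (halfcut l T).
  apply: nrm_le => // [i|]; last exact: ell_halfcut.
  rewrite /halfcut; case: (leP (l + 1) i) => li; last by rewrite Normc.normc0 normc_ge0.
  by rewrite (_ : l <= i)//; clear -li; lia.
have H4 : eta * normc (y l) <= nrm (halfcut l T).
  apply: le_trans (normc_le_nrm p1 l (ell_halfcut p1 l Tp)).
  rewrite /halfcut lexx /T /tri (sy (l - 1 - 1)) ?(sy (l - 1)); try by clear; lia.
  by rewrite !mulr0 !add0r subrK Normc.normcM ler_wpM2r ?normc_ge0.
have H5 : normc w * normc (y l) <= normc w / eta * nrm (halfcut l T).
  rewrite -mulrA ler_wpM2l ?normc_ge0//.
  by rewrite mulrC ler_pdivlMr// mulrC.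
rewrite mulrAC ler_pdivrMr//.
have N0 : 0 <= nrm y by exact: nrm_ge0.
have E0 : 0 <= 3 * e * nrm y by rewrite !mulr_ge0.
have : 3 * e * nrm y <= 3 * e * nrm y * q by rewrite ler_peMr.
have -> : (nrm (halfcut l T) + 3 * e * nrm y) * q =
    nrm (halfcut l T) + normc w / eta * nrm (halfcut l T) + 3 * e * nrm y * q.
  by rewrite /q; ring.
move: H5 H1 H2 H3; lra.
Qed.

End CornerBounds.

Section Cutoff.
Variables (al be ga : int -> C) (s : int) (M : R).
Hypothesis s1 : `|s| <= 1.
Hypothesis bd :
  forall i, normc (al i) <= M /\ normc (be i) <= M /\ normc (ga i) <= M.
Local Notation T := (tri al be ga s).

Definition damp (phi : int -> R) x : int -> C := fun i => (phi i)%:C%C * x i.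

Lemma normc_real (t : R) : normc (t%:C%C : C) = `|t|.
Proof. by rewrite /= expr0n /= addr0 sqrtr_sqr. Qed.

Lemma ell_damp (phi : int -> R) x : (forall i, `|phi i| <= 1) ->
  ell p x -> ell p (damp phi x) /\ nrm (damp phi x) <= nrm x.
Proof.
move=> phi1 xp; rewrite -[X in _ /\ _ <= X]mul1r.
apply: (nrm_dom p1 (s := 0)) => // i.
by rewrite addr0 /damp Normc.normcM normc_real ler_wpM2r ?normc_ge0.
Qed.

(** Entry [(i, j)] of the commutator is the matrix entry times [phi j - phi i] with [|j - i| <= 2],
    hence at most [2 e M]; there are three diagonals. *)
Lemma commutator (phi : int -> R) (e : R) x :
  (forall i, `|phi (i + 1) - phi i| <= e) -> ell p x ->
  let g := fun i => T (damp phi x) i - damp phi (T x) i in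
  ell p g /\ nrm g <= 6 * M * e * nrm x.
Proof.
move=> lip xp g.
have M0 : 0 <= M by have := normc_ge0 (al 0); have [+ _] := bd 0; lra.
have e0 : 0 <= e by apply: le_trans (lip 0).
rewrite (_ : 6 * M * e = 3 * (2 * e * M)); last by ring.
apply: (nrm_dom3 p1 (s := s)) => //; first by rewrite !mulr_ge0.
move=> i.
have l2 t : `|t| <= 2 -> normc ((phi (i + t) - phi i)%:C%C : C) <= 2 * e.
  by move=> t2; rewrite normc_real; exact: lipschitz2.
rewrite (_ : g i = (phi (i + (s - 1)) - phi i)%:C%C * al (i + s) * x (i + s - 1)
  + (phi (i + s) - phi i)%:C%C * be (i + s) * x (i + s)
  + (phi (i + (s + 1)) - phi i)%:C%C * ga (i + s) * x (i + s + 1)); last first.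
  by rewrite /g /tri /damp !rmorphB/= !addrA; ring.
apply: le_trans (le_normcD _ _) _.
apply: le_trans (lerD (le_normcD _ _) (lexx _)) _.
have [b1 [b2 b3]] := bd (i + s); have N0 := @normc_ge0 R.
rewrite [leRHS]mulrDr [X in _ <= X + _]mulrDr.
rewrite ![normc (_ * _ * _)]Normc.normcM.
rewrite !lerD// ler_wpM2r// Normc.normcM ler_pM// l2//; lia.
Qed.

Lemma cutP_le l r x i : normc (cutP l r x i) <= normc (x i).
Proof. by rewrite /cutP; case: ifP => // _; rewrite Normc.normc0 normc_ge0. Qed.

Lemma ell_cutP l r x : ell p x -> ell p (cutP l r x) /\ nrm (cutP l r x) <= nrm x.
Proof.
move=> xp; split; first by apply: ell_le xp => // i; exact: cutP_le.
by apply: nrm_le => // i; exact: cutP_le.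
Qed.

Lemma damp_cut_le (phi : int -> R) (e : R) l r x : (forall i, `|phi i| <= 1) ->
  (forall i, `|phi (i + 1) - phi i| <= e) -> ell p x ->
  nrm (cutP l r (T (damp phi x))) <=
  nrm (cutP l r (T x)) + 6 * M * e * nrm x.
Proof.
move=> phi1 lip xp; have [gp ng] := commutator lip xp.
set g := (fun i => _) in gp ng.
have [Tp _] := ell_tri s bd xp.
have [cp _] := ell_cutP l r Tp.
have [dp nd] := ell_damp phi1 cp.
have [cgp ncg] := ell_cutP l r gp.
rewrite (_ : cutP l r (T (damp phi x)) =
  fun i => damp phi (cutP l r (T x)) i + cutP l r g i).
  apply: le_trans (nrmD p1 dp cgp) _; lra.
apply/funext => i; rewrite /cutP /damp /g; case: ifP => _.
  by rewrite addrC subrK.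
by rewrite mulr0 addr0.
Qed.

End Cutoff.
End Stability.

(** * Stability of finite sections *)

Section Ramp.
Variable R : realType.

Definition clamp (t : R) : R := Num.min 1 (Num.max 0 t).

Lemma clamp_lipschitz (a b : R) : `|clamp a - clamp b| <= `|a - b|.
Proof.
have := ler_norm (a - b); have := ler_norm (b - a); rewrite distrC => h1 h2.
rewrite ler_norml /clamp !minEle !maxEle.
by do !case: ifPn; rewrite -?ltNge; lra.
Qed.

Lemma clamp_ge0 t : 0 <= clamp t.
Proof. by rewrite /clamp minEle maxEle; do !case: ifPn; rewrite -?ltNge; lra. Qed.

Lemma clamp_le1 t : clamp t <= 1.
Proof. by rewrite /clamp ge_min lexx. Qed.

(** A cut-off descending linearly from 1 at [k - m] to 0 at [k]. Ascending ones are obtained by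
    evaluating at [- i]. *)
Definition ramp (k : int) (m : nat) (i : int) : R :=
  clamp ((k - i)%:~R / m%:R).

Lemma ramp_ge0 k m i : 0 <= ramp k m i. Proof. exact: clamp_ge0. Qed.
Lemma ramp_le1 k m i : ramp k m i <= 1. Proof. exact: clamp_le1. Qed.

Lemma ramp1 k m i : (0 < m)%N -> i <= k - m%:Z -> ramp k m i = 1.
Proof.
move=> m0 ikm; apply/min_idPl; rewrite le_max ler_pdivlMr ?ltr0n// mul1r.
by apply/orP; right; rewrite -[m%:R]/(m%:~R) ler_int; lia.
Qed.

Lemma ramp0 k m i : k <= i -> ramp k m i = 0.
Proof.
move=> ki; rewrite /ramp /clamp (_ : Num.max 0 _ = 0); last first.
  apply/max_idPl; rewrite mulr_le0_ge0 ?invr_ge0//.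
  by rewrite -[0]/(0%:~R) ler_int; lia.
by apply/min_idPr.
Qed.

Lemma ramp_lipschitz k m i : `|ramp k m (i + 1) - ramp k m i| <= m%:R^-1.
Proof.
apply: le_trans (clamp_lipschitz _ _) _.
rewrite -mulrBl -rmorphB/= (_ : k - (i + 1) - (k - i) = -1); last by ring.
by rewrite mulN1r normrN ger0_norm ?invr_ge0.
Qed.

Lemma ramp_opp_lipschitz k m i :
  `|ramp k m (- (i + 1)) - ramp k m (- i)| <= m%:R^-1.
Proof.
have := ramp_lipschitz k m (- (i + 1)).
by rewrite distrC (_ : - (i + 1) + 1 = - i)//; ring.
Qed.

End Ramp.

(** * Uniform lower bounds for finite sections, and decay of local errors *)

Section FiniteSection.
Variables (R : realType) (p : \bar R).
Hypothesis p1 : (1 <= p)%E.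
Local Notation C := R[i].
Local Notation normc := Normc.normc.
Local Notation nrm := (nrm p).
Local Notation ramp := (@ramp R).
Implicit Types (x y z f h al be ga : int -> C) (l r k s : int) (u v w : C).

Variables (al be ga : int -> C) (s : int) (M K : R).
Hypothesis s1 : `|s| <= 1.
Hypothesis bd :
  forall i, normc (al i) <= M /\ normc (be i) <= M /\ normc (ga i) <= M.
Local Notation T := (tri al be ga s).
Hypothesis K0 : 0 <= K.
Hypothesis below : forall x, ell p x -> nrm x <= K * nrm (T x).

(** Reflection turns right corners into left ones. *)
Lemma tri_opp x i :
  tri (ga \o -%R) (be \o -%R) (al \o -%R) (- s) (x \o -%R) i = T x (- i).
Proof.
rewrite /tri /=; have -> : - (i - s) = - i + s by ring.
have -> : - (i - s - 1) = - i + s + 1 by ring.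
have -> : - (i - s + 1) = - i + s - 1 by ring.
by ring.
Qed.

Lemma stability u v w (kappa : R) : 0 < kappa ->
  left_corner p al be ga s u v w kappa ->
  left_corner p (ga \o -%R) (be \o -%R) (al \o -%R) (- s) w v u kappa ->
  exists K' m0, [/\ 0 <= K', (0 < m0)%N & forall l r, l + m0%:Z <= r ->
    (forall i, (l <= i <= l + m0%:Z) || (r - m0%:Z <= i <= r) ->
       close al be ga u v w m0%:R^-1 i) ->
    forall x, supported l r x -> nrm x <= K' * nrm (cutP l r (T x))].
Proof.
move=> kap0 lc rc.
have M0 : 0 <= M by have := normc_ge0 (al 0); have [+ _] := bd 0; lra.
(* [Q e] is the factor with which the norm of [x] reappears on the right: [6 M (2 e) K] from the
   middle part and [(6 M + 3) e / kappa] from each end. The choice of [m] gives [Q e <= 1/2]. *)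
pose Q := 12 * M * K + 2 * (6 * M + 3) / kappa.
have Q0 : 0 <= Q.
  by rewrite addr_ge0 ?divr_ge0 ?mulr_ge0 ?addr_ge0 ?mulr_ge0// ltW.
have [m mQ] : exists m : nat, 2 * Q + 1 < m%:R.
  by exists (Num.trunc (2 * Q + 1)).+1; exact: truncnS_gt.
have m0 : (0 < m)%N by rewrite -(ltr_nat R); lra.
(* The factor 2 results from absorbing half of the norm of [x]. The ten extra indices leave room for
   the plateaus of the ramps and the reach of the rows. *)
exists (2 * (K + 2 / kappa)), (m + 10)%N; split.
- by rewrite mulr_ge0 ?addr_ge0 ?divr_ge0// ltW.
- lia.
move=> l r lr cl x sx; have xp := ell_supported p1 sx.
have em : ((m + 10)%:R : R)^-1 <= m%:R^-1.
  by rewrite lef_pV2 ?posrE ?ltr0n ?ler_nat//; lia.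
set e : R := m%:R^-1 in em.
have e0 : 0 <= e by rewrite invr_ge0.
have em1 : e * m%:R = 1 by rewrite mulVf// pnatr_eq0; lia.
have {}cl i : (l <= i <= l + m%:Z + 2) || (r - m%:Z - 2 <= i <= r) ->
    close al be ga u v w e i.
  by move=> hi; apply: le_trans em; apply: cl; lia.
(* Partition of unity: [fL] is 1 up to [l + 2] and 0 from [l + m + 2] on, and [fR] is its mirror
   image. So the middle part lives on [[l + 3, r - 3]], a margin that makes cutting its image under
   [T] harmless. *)
pose fL := ramp (l + m%:Z + 2) m.
pose fR i := ramp (- (r - m%:Z - 2)) m (- i).
pose fM i := 1 - fL i - fR i.
have fLb i : `|fL i| <= 1 by rewrite ger0_norm ?ramp_ge0 ?ramp_le1.
have fRb i : `|fR i| <= 1 by rewrite ger0_norm ?ramp_ge0 ?ramp_le1.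
have fMb i : `|fM i| <= 1.
  have := @ramp_ge0 R (l + m%:Z + 2) m i; have := @ramp_le1 R (l + m%:Z + 2) m i.
  have := @ramp_ge0 R (- (r - m%:Z - 2)) m (- i).
  have := @ramp_le1 R (- (r - m%:Z - 2)) m (- i).
  by rewrite ler_norml /fM /fL /fR; lra.
have fLl i : `|fL (i + 1) - fL i| <= e by exact: ramp_lipschitz.
have fRl i : `|fR (i + 1) - fR i| <= e by exact: ramp_opp_lipschitz.
have fMl i : `|fM (i + 1) - fM i| <= 2 * e.
  rewrite (_ : fM (i + 1) - fM i = - (fL (i + 1) - fL i) - (fR (i + 1) - fR i));
    last by rewrite /fM; ring.
  apply: le_trans (ler_normB _ _) _; rewrite normrN.
  have := fLl i; have := fRl i; lra.
have [Lp nL] := ell_damp p1 fLb xp.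
have [Rp nR] := ell_damp p1 fRb xp.
have [Mp nM] := ell_damp p1 fMb xp.
have cL := damp_cut_le p1 s1 bd l r fLb fLl xp.
have cR := damp_cut_le p1 s1 bd l r fRb fRl xp.
have cM := damp_cut_le p1 s1 bd l r fMb fMl xp.
have sL : supported l (l + (m.+1)%:Z) (damp fL x).
  move=> i ni; rewrite /damp; have [il|il] := leP (l + m%:Z + 2) i.
    by rewrite /fL ramp0// mul0r.
  by rewrite sx ?mulr0//; apply: contraNN ni; clear -il; lia.
have sR : supported (r - (m.+1)%:Z) r (damp fR x).
  move=> i ni; rewrite /damp; have [il|il] := leP i (r - m%:Z - 2).
    by rewrite /fR ramp0 ?mul0r// lerN2.
  by rewrite sx ?mulr0//; apply: contraNN ni; clear -il; lia.
have sM : supported (l + 3) (r - 3) (damp fM x).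
  move=> i ni; rewrite /damp /fM; have [il|il] := leP i (l + 2).
    rewrite /fL ramp1//; last by (clear -il; lia).
    by rewrite /fR ramp0 ?subrr ?subr0 ?mul0r//; clear -il lr; lia.
  have [ir|ir] := leP (r - 2) i.
    rewrite /fR ramp1//; last by (clear -ir; lia).
    by rewrite /fL ramp0 ?subr0 ?subrr ?mul0r//; clear -ir lr; lia.
  by exfalso; clear -ni il ir; lia.
have HL : kappa * nrm (damp fL x) <=
    nrm (cutP l r (T (damp fL x))) + 3 * e * nrm (damp fL x).
  apply: le_trans (lc l e m.+1 _ e0 _ sL) _.
    by move=> i hi; apply: cl; clear -hi; lia.
  rewrite lerD2r; apply: nrm_le => // [i|].
    rewrite /halfcut /cutP; case: (leP l i) => li; last first.
      by rewrite Normc.normc0 ?normc_ge0.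
    rewrite andTb; case: (leP i r) => ir//; rewrite (supported_ell_tri _ _ _ s1 sL) ?Normc.normc0//.
    clear -ir lr; lia.
  exact: (ell_cutP p1 l r (ell_tri_supported p1 _ _ _ s1 sL)).1.
have HR : kappa * nrm (damp fR x) <=
    nrm (cutP l r (T (damp fR x))) + 3 * e * nrm (damp fR x).
  have cp := (ell_cutP p1 l r (ell_tri_supported p1 al be ga s1 sR)).1.
  rewrite -(nrm_opp p1 (damp fR x)) -(nrm_opp p1 (cutP _ _ _)).
  apply: le_trans (rc (- r) e m.+1 _ e0 _ _) _.
  - move=> i hi; rewrite /close /=.
    have : close al be ga u v w e (- i) by apply: cl; clear -hi; lia.
    by rewrite /close; lra.
  - by move=> i ni; apply: sR; apply: contraNN ni; clear; lia.
  rewrite lerD2r; apply: nrm_le => // [i|]; last exact: ell_opp.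
  rewrite /halfcut /cutP; case: (leP (- r) i) => li; last first.
    by rewrite Normc.normc0 ?normc_ge0.
  rewrite tri_opp; case: ifPn => // nir.
  rewrite (supported_ell_tri _ _ _ s1 sR) ?Normc.normc0//; clear -nir li lr s1; lia.
have HM : nrm (damp fM x) <= K * nrm (cutP l r (T (damp fM x))).
  apply: le_trans (below Mp) _; rewrite ler_wpM2l//; apply: nrm_le => // [i|].
    rewrite /cutP; case: ifPn => // ni.
    rewrite /tri !sM ?mulr0 ?addr0 ?Normc.normc0//; clear -ni s1; lia.
  exact: (ell_cutP p1 l r (ell_tri_supported p1 _ _ _ s1 sM)).1.
have X3 : nrm x <= nrm (damp fL x) + nrm (damp fR x) + nrm (damp fM x).
  apply: le_trans (le_trans (nrmD p1 (ellD p1 Lp Rp) Mp) _); last first.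
    by rewrite lerD2r; exact: nrmD.
  rewrite le_eqVlt; apply/orP; left; apply/eqP; congr nrm; apply/funext => i.
  rewrite /damp -!mulrDl -!rmorphD (_ : fL i + fR i + fM i = 1) ?mul1r//.
  by rewrite /fM; ring.
set X := nrm x in X3 nL nR nM cL cR cM *.
set P := nrm (cutP l r (T x)) in cL cR cM *.
have X0 : 0 <= X := nrm_ge0 p x.
have P0 : 0 <= P := nrm_ge0 p _.
have eL : nrm (damp fL x) <= (P + (6 * M + 3) * e * X) / kappa.
  rewrite ler_pdivlMr// mulrC; apply: le_trans HL _.
  have : 3 * e * nrm (damp fL x) <= 3 * e * X by rewrite ler_wpM2l// mulr_ge0.
  lra.
have eR : nrm (damp fR x) <= (P + (6 * M + 3) * e * X) / kappa.
  rewrite ler_pdivlMr// mulrC; apply: le_trans HR _.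
  have : 3 * e * nrm (damp fR x) <= 3 * e * X by rewrite ler_wpM2l// mulr_ge0.
  lra.
have eM : nrm (damp fM x) <= K * (P + 6 * M * (2 * e) * X).
  by apply: le_trans HM _; rewrite ler_wpM2l.
have key : X <= (K + 2 / kappa) * P + Q * e * X.
  apply: le_trans X3 _; apply: le_trans (lerD (lerD eL eR) eM) _.
  by rewrite /Q le_eqVlt; apply/orP; left; apply/eqP; ring.
have Qe : Q * e <= 1 / 2.
  have : 2 * Q * e <= m%:R * e by rewrite ler_wpM2r//; lra.
  by rewrite [m%:R * e]mulrC em1; lra.
have : Q * e * X <= 1 / 2 * X by rewrite ler_wpM2r.
lra.
Qed.

(** For a tent [f] of width [N] around [k], [T (f z)] equals the commutator applied to [z], because
    [T z] vanishes where [f] does not. The commutator is of order [1 / N], and [below] carries this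
    over to [f z]. *)
Lemma local_bound (N : nat) l r k z : (0 < N)%N -> supported l r z ->
  l <= k - N%:Z -> k + N%:Z <= r ->
  (forall i, k - N%:Z <= i <= k + N%:Z -> T z i = 0) ->
  normc (z k) <= 12 * K * M / N%:R * nrm z.
Proof.
move=> N0 sz lk kr Tz; have zp := ell_supported p1 sz.
(* A tent with value 1 at [k] and slopes [1 / N], zero outside [[k - N, k + N]]. *)
pose f i := ramp (k + N%:Z) N i + ramp (- k + N%:Z) N (- i) - 1.
have fb i : `|f i| <= 1.
  have := @ramp_ge0 R (k + N%:Z) N i; have := @ramp_le1 R (k + N%:Z) N i.
  have := @ramp_ge0 R (- k + N%:Z) N (- i).
  have := @ramp_le1 R (- k + N%:Z) N (- i).
  by rewrite ler_norml /f; lra.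
have fl i : `|f (i + 1) - f i| <= 2 * N%:R^-1.
  have h1 := @ramp_lipschitz R (k + N%:Z) N i.
  have h2 := @ramp_opp_lipschitz R (- k + N%:Z) N i.
  rewrite (_ : f (i + 1) - f i = (ramp (k + N%:Z) N (i + 1) - ramp (k + N%:Z) N i)
   + (ramp (- k + N%:Z) N (- (i + 1)) - ramp (- k + N%:Z) N (- i)));
    last by rewrite /f; ring.
  by apply: le_trans (ler_normD _ _) _; lra.
have [fp nf] := ell_damp p1 fb zp.
have [gp ng] := commutator p1 s1 bd fl zp.
have fk : f k = 1 by rewrite /f !ramp1//; [ring|lia|lia].
have f0 i : ~~ (k - N%:Z <= i <= k + N%:Z) -> f i = 0.
  rewrite /f; have [ik|ik] := leP i k => ni.
    by rewrite (@ramp0 R (- k + N%:Z) N) ?ramp1//; [ring|lia|lia].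
  by rewrite (@ramp0 R (k + N%:Z) N) ?ramp1//; [ring|lia|lia].
have -> : z k = damp f z k by rewrite /damp fk mul1r.
apply: le_trans (normc_le_nrm p1 k fp) _; apply: le_trans (below fp) _.
rewrite (_ : 12 * K * M / N%:R * nrm z = K * (6 * M * (2 * N%:R^-1) * nrm z));
  last by ring.
rewrite ler_wpM2l//; apply: le_trans ng; rewrite le_eqVlt; apply/orP; left.
apply/eqP; congr nrm; apply/funext => i.
have [ki|ki] := boolP (k - N%:Z <= i <= k + N%:Z).
  by rewrite [damp f (T z) i]/damp Tz// mulr0 subr0.
by rewrite [damp f (T z) i]/damp f0// mul0r subr0.
Qed.

End FiniteSection.

(** * Zeros of the symbol and decaying null vectors *)

Section Recurrences.
Variable R : realType.
Local Notation C := R[i].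
Local Notation normc := Normc.normc.

Definition vanishing (f : nat -> C) : Prop :=
  forall e : R, 0 < e -> exists N, forall n, (N <= n)%N -> normc (f n) <= e.

Lemma geometric_small (rho K e : R) : 0 <= rho < 1 -> 0 < e ->
  exists N, forall n, (N <= n)%N -> K * rho ^+ n <= e.
Proof.
move=> /andP[r0 r1] e0.
have h : (fun n => K * rho ^+ n) @ \oo --> (K * 0 : R).
  by apply: cvgMr; apply: cvg_expr; rewrite ger0_norm.
rewrite mulr0 in h.
have [N _ HN] := (cvgrPdist_le _ _).1 h e e0.
exists N => n Nn; have := HN n Nn; rewrite /= sub0r normrN.
by apply: le_trans; exact: ler_norm.
Qed.

(** Once [g] is below [(1 - rho) e / 2], the bound iterates [t -> rho t + (1 - rho) e / 2], whose
    fixed point is [e / 2]; the deviation from it decays geometrically. *)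
Lemma vanishing_contraction (rho : R) (f g : nat -> C) : 0 <= rho < 1 ->
  vanishing g -> (forall n, normc (f n.+1) <= rho * normc (f n) + normc (g n)) ->
  vanishing f.
Proof.
move=> r01 vg fg e e0; have /andP[r0 r1] := r01.
have e2 : 0 < (1 - rho) * (e / 2) by rewrite mulr_gt0 ?subr_gt0 ?divr_gt0.
have [N HN] := vg _ e2.
have [N' HN'] := geometric_small (normc (f N)) r01 (divr_gt0 e0 (ltr0n _ 2)).
have H n : normc (f (N + n)%N) <= e / 2 + normc (f N) * rho ^+ n.
  elim: n => [|n IH]; first by rewrite addn0 expr0 mulr1 lerDr ltW// divr_gt0.
  rewrite addnS; apply: le_trans (fg _) _.
  have := HN (N + n)%N (leq_addr _ _).
  have : rho * normc (f (N + n)%N) <= rho * (e / 2 + normc (f N) * rho ^+ n).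
    by rewrite ler_wpM2l.
  rewrite exprS; lra.
exists (N + N')%N => n Nn.
have := H (n - N)%N; rewrite subnKC; last by lia.
have := HN' (n - N)%N; rewrite leq_subRL; last by lia.
by move=> /(_ Nn); lra.
Qed.

(** Both zeros [- b / a] and [- d / c] lie inside the disc, so every solution decays and the initial
    values are free. The combination [f (n + 1) + (d / c) f n] is geometric with ratio [- b / a],
    and [f] is a contraction driven by it; double zeros need no separate treatment. *)
Lemma decaying_solution2 (a b c d f0 f1 : C) : normc b < normc a ->
  normc d < normc c -> exists f : nat -> C, [/\ f 0%N = f0, f 1%N = f1,
    vanishing f &
    forall n, (b * d) * f n + (a * d + b * c) * f n.+1 + (a * c) * f n.+2 = 0].
Proof.
move=> ba dc.
have gt0 (x y : C) : normc x < normc y -> 0 < normc y.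
  by apply: le_lt_trans; exact: normc_ge0.
have neq0 (x y : C) : normc x < normc y -> y != 0.
  by move=> xy; apply/eqP => y0; have := gt0 _ _ xy; rewrite y0 Normc.normc0 ltxx.
have a0 := neq0 _ _ ba; have c0 := neq0 _ _ dc.
have ap := gt0 _ _ ba; have cp := gt0 _ _ dc.
pose step (q : C * C) := (q.2, - ((b * d) * q.1 + (a * d + b * c) * q.2) / (a * c)).
pose f n := (iter n step (f0, f1)).1.
have f2 n : (iter n step (f0, f1)).2 = f n.+1 by [].
have rec n : (b * d) * f n + (a * d + b * c) * f n.+1 + (a * c) * f n.+2 = 0.
  have -> : f n.+2 = - ((b * d) * f n + (a * d + b * c) * f n.+1) / (a * c) by [].
  by field; rewrite a0 c0.
exists f; split => //.
pose g n := (c * f n.+1 + d * f n) / c.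
have ratio (x y : C) : normc x < normc y -> 0 <= normc x / normc y < 1.
  move=> xy; rewrite divr_ge0 ?normc_ge0//= ltr_pdivrMr ?mul1r//.
  exact: gt0 xy.
apply: (@vanishing_contraction (normc d / normc c) f g); first exact: ratio.
  apply: (@vanishing_contraction (normc b / normc a) g (fun=> 0)).
  - exact: ratio.
  - by move=> e e0; exists 0%N => n _; rewrite Normc.normc0 ltW.
  move=> n; rewrite Normc.normc0 addr0.
  have -> : g n.+1 = - (b / a) * g n.
    rewrite /g; have : f n.+2 = - ((b * d) * f n + (a * d + b * c) * f n.+1) / (a * c) by [].
    by move=> ->; field; rewrite a0 c0.
  by rewrite Normc.normcM normcN Normc.normcM Normc.normcV.
move=> n; have -> : f n.+1 = g n - (d / c) * f n by rewrite /g; field.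
apply: le_trans (le_normcD _ _) _.
by rewrite normcN !Normc.normcM Normc.normcV addrC.
Qed.

(** With only the zero [- d / c] known to lie inside, its powers are a decaying solution, non-zero
    at index 0. *)
Lemma decaying_solution1 (a b c d : C) : normc d < normc c ->
  exists f : nat -> C, [/\ f 0%N = 1, vanishing f &
    forall n, (b * d) * f n + (a * d + b * c) * f n.+1 + (a * c) * f n.+2 = 0].
Proof.
move=> dc.
have cp : 0 < normc c by apply: le_lt_trans dc; exact: normc_ge0.
have c0 : c != 0 by apply/eqP => c0; move: cp; rewrite c0 Normc.normc0 ltxx.
exists (fun n => (- (d / c)) ^+ n); split => //.
  apply: (@vanishing_contraction (normc d / normc c) _ (fun=> 0)).
  - by rewrite divr_ge0 ?normc_ge0//= ltr_pdivrMr ?mul1r.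
  - by move=> e e0; exists 0%N => n _; rewrite Normc.normc0 ltW.
  by move=> n; rewrite exprS Normc.normcM normcN Normc.normcM Normc.normcV Normc.normc0 addr0.
by move=> n; rewrite !exprS; field.
Qed.

End Recurrences.

(** * Factorization of the symbol and the position of its zeros *)

Section Factorization.
Variable R : realType.
Local Notation C := R[i].
Local Notation normc := Normc.normc.
Implicit Types a b c d u v w : C.

(* [u + v t + w t^2 = (a t + b) (c t + d)]; a vanishing leading coefficient
   [a] or [c] stands for a root at infinity. *)
Definition factors u v w a b c d : Prop :=
  [/\ u = b * d, v = a * d + b * c & w = a * c].

Lemma factors_swap u v w a b c d :
  factors u v w a b c d -> factors u v w c d a b.
Proof. by case=> -> -> ->; split; ring. Qed.

Lemma factors_rev u v w a b c d :
  factors u v w a b c d -> factors w v u d c b a.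
Proof. by case=> -> -> ->; split; ring. Qed.

(** The quadratic formula; for [w = 0] the symbol is itself the second factor and the first one is
    the constant 1. *)
Lemma factors_exist u v w : exists a b c d, factors u v w a b c d.
Proof.
have [->|w0] := eqVneq w 0.
  by exists 0, 1, v, u; split; ring.
pose s := sqrtC (v ^+ 2 - 4 * u * w).
have ss : s ^+ 2 = v ^+ 2 - 4 * u * w := sqrtCK _.
exists w, ((v + s) / 2), 1, ((v - s) / (2 * w)); split.
- have -> : (v + s) / 2 * ((v - s) / (2 * w)) = (v ^+ 2 - s ^+ 2) / (4 * w).
    by field.
  by rewrite ss; field.
- by field.
- by rewrite mulr1.
Qed.

Lemma normcX2 (z : C) : normc (z ^+ 2) = normc z ^+ 2.
Proof. by rewrite !expr2 Normc.normcM. Qed.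

Lemma normc_parallelogram (x y : C) :
  normc (x + y) ^+ 2 + normc (x - y) ^+ 2 = 2 * (normc x ^+ 2 + normc y ^+ 2).
Proof.
case: x y => [x1 x2] [y1 y2]; rewrite /Normc.normc /=.
by rewrite !sqr_sqrtr ?addr_ge0 ?sqr_ge0//; ring.
Qed.

(* With [x ^ 2 = a d] and [y ^ 2 = b c] the numbers [v +- 2 sqrt (u w)] are the
   squares [(x +- y) ^ 2], so that [Delta] is given by the parallelogram law. *)
Lemma Delta_factors u v w a b c d : factors u v w a b c d ->
  Delta u v w = 2 * ((normc a - normc b) * (normc d - normc c)).
Proof.
case=> -> -> ->; rewrite /Delta.
pose x := sqrtC (a * d); pose y := sqrtC (b * c).
have x2 : x ^+ 2 = a * d := sqrtCK _.
have y2 : y ^+ 2 = b * c := sqrtCK _.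
set s := sqrtC _; have s2 : s ^+ 2 = (x * y) ^+ 2.
  by rewrite sqrtCK exprMn x2 y2; ring.
have E : normc (a * d + b * c + 2 * s) + normc (a * d + b * c - 2 * s) =
    normc ((x + y) ^+ 2) + normc ((x - y) ^+ 2).
  have p1 : (x + y) ^+ 2 = a * d + b * c + 2 * (x * y) by rewrite -x2 -y2; ring.
  have p2 : (x - y) ^+ 2 = a * d + b * c - 2 * (x * y) by rewrite -x2 -y2; ring.
  move/eqP: s2; rewrite eqf_sqr => /orP[/eqP ->|/eqP ->]; first by rewrite p1 p2.
  by rewrite p1 p2 addrC mulrN opprK.
rewrite E !normcX2 normc_parallelogram -!normcX2 x2 y2 !Normc.normcM; ring.
Qed.

(** Stretching [b] radially by [e] makes the inequality strict; [b = 0] has no direction and is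
    replaced by [e]. *)
Lemma normc_perturb a b (e : R) : 0 < e -> normc a <= normc b ->
  exists2 b', normc a < normc b' & normc (b' - b) <= e.
Proof.
move=> e0 ab.
have ne : normc (e%:C%C : C) = e by rewrite normc_real gtr0_norm.
have [b0|b0] := eqVneq b 0.
  exists e%:C%C; last by rewrite b0 subr0 ne.
  by rewrite ne; apply: le_lt_trans e0; rewrite (le_trans ab)// b0 Normc.normc0.
have nb : 0 < normc b.
  rewrite lt_neqAle normc_ge0 andbT eq_sym; apply: contra_neq b0.
  exact: Normc.eq0_normc.
exists (b * (1 + e / normc b)%:C%C).
  rewrite Normc.normcM normc_real ger0_norm; last first.
    by rewrite addr_ge0// divr_ge0// ltW.
  by rewrite mulrDr mulr1 mulrCA mulfV ?gt_eqF// mulr1; lra.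
rewrite (_ : b * _ - b = b * (e / normc b)%:C%C); last first.
  by rewrite rmorphD rmorph1; ring.
rewrite Normc.normcM normc_real ger0_norm; last by rewrite divr_ge0// ltW.
by rewrite mulrCA mulfV ?gt_eqF// mulr1.
Qed.

Lemma symbol_continuous a b c d (e : R) : 0 < e -> exists2 t : R, 0 < t &
  forall a' b' c' d', normc (a' - a) <= t -> normc (b' - b) <= t ->
    normc (c' - c) <= t -> normc (d' - d) <= t ->
  [/\ normc (b' * d' - b * d) <= e,
      normc (a' * d' + b' * c' - (a * d + b * c)) <= e &
      normc (a' * c' - a * c) <= e].
Proof.
move=> e0.
pose S := 1 + (normc a + normc b + normc c + normc d).
have na := normc_ge0 a; have nb := normc_ge0 b.
have nc := normc_ge0 c; have nd := normc_ge0 d.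
have S0 : 0 < S by rewrite /S; lra.
(* The bound [t <= 1] tames the quadratic term, so each product moves by at most [2 S t]; the middle
   coefficient consists of two products, hence [4 S t <= e]. *)
pose t := Num.min 1 (e / (4 * S)).
have t0 : 0 < t by rewrite lt_min ltr01 divr_gt0 ?mulr_gt0.
have t1 : t <= 1 by rewrite ge_min lexx.
have St : 4 * S * t <= e.
  by rewrite mulrC -ler_pdivlMr ?mulr_gt0// ge_min lexx orbT.
exists t => // a' b' c' d' ha hb hc hd.
have prod (x y x' y' : C) : normc x <= S - 1 -> normc y <= S - 1 ->
    normc (x' - x) <= t -> normc (y' - y) <= t ->
    normc (x' * y' - x * y) <= 2 * S * t.
  move=> xS yS hx hy.
  rewrite (_ : x' * y' - x * y = (x' - x) * (y' - y) + x * (y' - y) + y * (x' - x));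
    last by ring.
  apply: le_trans (le_normcD _ _) _.
  apply: le_trans (lerD (le_normcD _ _) (lexx _)) _; rewrite !Normc.normcM.
  have h1 : normc (x' - x) * normc (y' - y) <= t * 1.
    by rewrite ler_pM ?normc_ge0// (le_trans hy).
  have h2 : normc x * normc (y' - y) <= (S - 1) * t by rewrite ler_pM ?normc_ge0.
  have h3 : normc y * normc (x' - x) <= (S - 1) * t by rewrite ler_pM ?normc_ge0.
  lra.
have aS : normc a <= S - 1 by rewrite /S; lra.
have bS : normc b <= S - 1 by rewrite /S; lra.
have cS : normc c <= S - 1 by rewrite /S; lra.
have dS : normc d <= S - 1 by rewrite /S; lra.
have St0 : 0 <= S * t by rewrite mulr_ge0// ltW.
split.
- by apply: le_trans (prod _ _ _ _ bS dS hb hd) _; lra.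
- rewrite (_ : _ - _ = (a' * d' - a * d) + (b' * c' - b * c)); last by ring.
  apply: le_trans (le_normcD _ _) _.
  have := prod _ _ _ _ aS dS ha hd; have := prod _ _ _ _ bS cS hb hc; lra.
- by apply: le_trans (prod _ _ _ _ aS cS ha hc) _; lra.
Qed.

(* [in1], [in2]: at least one, two zeros of the symbol in the closed unit disc;
   [out1], [out2]: outside the open unit disc. A zero on the circle counts for
   both. *)
Definition in1 u v w := exists a b c d, factors u v w a b c d /\ normc d <= normc c.
Definition out1 u v w := exists a b c d, factors u v w a b c d /\ normc c <= normc d.
Definition in2 u v w := exists a b c d,
  [/\ factors u v w a b c d, normc b <= normc a & normc d <= normc c].
Definition out2 u v w := exists a b c d,
  [/\ factors u v w a b c d, normc a <= normc b & normc c <= normc d].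

Lemma in2_in1 u v w : in2 u v w -> in1 u v w.
Proof. by move=> [a [b [c [d [? _ ?]]]]]; exists a, b, c, d. Qed.

Lemma case_a_in1_out1 u v w : case_a u v w -> in1 u v w /\ out1 u v w.
Proof.
have [a [b [c [d F]]]] := factors_exist u v w.
rewrite /case_a (Delta_factors F) => D.
have [dc|cd] := leP (normc d) (normc c).
  split; first by exists a, b, c, d.
  exists c, d, a, b; split; first exact: factors_swap.
  by rewrite leNgt; apply/negP => ba; nra.
split; last by exists a, b, c, d; split => //; exact: ltW.
exists c, d, a, b; split; first exact: factors_swap.
by rewrite leNgt; apply/negP => ba; nra.
Qed.

(** By [Delta_factors] a negative sign puts both zeros on the same side of the unit circle. *)
Lemma negative_Delta u v w : Delta u v w < 0 -> exists a b c d,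
  factors u v w a b c d /\
  ((normc a < normc b /\ normc c < normc d) \/
   (normc b < normc a /\ normc d < normc c)).
Proof.
have [a [b [c [d F]]]] := factors_exist u v w.
rewrite (Delta_factors F) => D; exists a, b, c, d; split => //.
by case: (ltgtP (normc a) (normc b)) => h1; case: (ltgtP (normc c) (normc d)) => h2;
  (try by left); (try by right); exfalso; nra.
Qed.

(** One zero is inside and one outside; the factors are ordered with the inner zero first, as the
    Wiener-Hopf bound [left_corner0] requires. *)
Lemma case_aP u v w : case_a u v w -> exists a b c d,
  [/\ factors u v w a b c d, normc b < normc a & normc c < normc d].
Proof.
have [a [b [c [d F]]]] := factors_exist u v w.
rewrite /case_a (Delta_factors F) => D.
have [ba|ab] := ltP (normc b) (normc a).
  exists a, b, c, d; split => //; rewrite ltNge; apply/negP => dc; nra.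
exists c, d, a, b; split; first exact: factors_swap.
  by rewrite ltNge; apply/negP => dc; nra.
by rewrite lt_neqAle ab andbT; apply/eqP => abE; move: D; rewrite abE subrr mul0r mulr0 ltxx.
Qed.

Lemma case_bP u v w : case_b u v w -> exists a b c d,
  [/\ factors u v w a b c d, normc a < normc b & normc c < normc d].
Proof.
move=> [/negative_Delta[a [b [c [d [F [[ab cd]|[ba dc]]]]]]] wu].
  by exists a, b, c, d.
exfalso; case: F wu => -> _ ->; rewrite !Normc.normcM.
have := normc_ge0 b; have := normc_ge0 d; nra.
Qed.

Lemma case_cP u v w : case_c u v w -> exists a b c d,
  [/\ factors u v w a b c d, normc b < normc a & normc d < normc c].
Proof.
move=> [/negative_Delta[a [b [c [d [F [[ab cd]|[ba dc]]]]]]] wu]; last first.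
  by exists a, b, c, d.
exfalso; case: F wu => -> _ ->; rewrite !Normc.normcM.
have := normc_ge0 a; have := normc_ge0 c; nra.
Qed.

Lemma case_b_out2 u v w : case_b u v w -> out2 u v w.
Proof.
by move=> /case_bP[a [b [c [d [F ab cd]]]]]; exists a, b, c, d; split => //; exact: ltW.
Qed.

Lemma case_c_in2 u v w : case_c u v w -> in2 u v w.
Proof.
by move=> /case_cP[a [b [c [d [F ab cd]]]]]; exists a, b, c, d; split => //; exact: ltW.
Qed.

(** A factor whose two coefficients have equal modulus counts both as inside and as outside; the
    other factor decides between the alternatives. *)
Lemma zero_Delta u v w : Delta u v w = 0 ->
  (out2 u v w /\ in1 u v w) \/ (out1 u v w /\ in2 u v w).
Proof.
have [a [b [c [d F]]]] := factors_exist u v w; have F' := factors_swap F.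
rewrite (Delta_factors F) => /eqP; rewrite !mulf_eq0 pnatr_eq0 /= !subr_eq0.
case/orP => /eqP e.
  have [cd|dc] := leP (normc c) (normc d).
    by left; split; [exists a, b, c, d; rewrite e|exists c, d, a, b; rewrite e].
  right; split; first by exists c, d, a, b; rewrite e.
  by exists a, b, c, d; split => //; [rewrite e|exact: ltW].
have [ab|ba] := leP (normc a) (normc b).
  by left; split; exists a, b, c, d; rewrite e.
right; split; exists a, b, c, d; first by rewrite e.
by split => //; [exact: ltW|rewrite e].
Qed.

Lemma Delta_trichotomy u v w : Delta u v w != 0 ->
  [\/ case_a u v w, case_b u v w | case_c u v w].
Proof.
case: (ltgtP (Delta u v w) 0) => // D _; last by constructor 1.
have [a [b [c [d [[eu _ ew] H]]]]] := negative_Delta D.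
rewrite /case_b /case_c D eu ew !Normc.normcM.
have na := normc_ge0 a; have nb := normc_ge0 b.
have nc := normc_ge0 c; have nd := normc_ge0 d.
case: H => -[h1 h2]; [constructor 2|constructor 3]; split => //; nra.
Qed.

End Factorization.

(** * Pseudoergodicity and the lower bound exclude decaying null vectors *)

Section NoNullVector.
Variables (R : realType) (p : \bar R).
Hypothesis p1 : (1 <= p)%E.
Local Notation C := R[i].
Local Notation normc := Normc.normc.
Local Notation nrm := (nrm p).

Variables (U V W : set C) (al be ga : int -> C) (K : R).
Hypothesis K0 : 0 <= K.
Hypothesis below : forall x, ell p x -> nrm x <= K * nrm (tri al be ga 0 x).
Hypothesis patterns : forall (e : R) (n : nat) (bu bv bw : nat -> C), 0 < e ->
  (forall i, U (bu i) /\ V (bv i) /\ W (bw i)) ->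
  exists k : int, forall i : nat, (1 <= i <= n)%N ->
    [/\ normc (al (k + i%:Z) - bu i) <= e, normc (be (k + i%:Z) - bv i) <= e &
        normc (ga (k + i%:Z) - bw i) <= e].

(** Perturbed triples need not belong to [U x V x W]; closeness to a triple that does is enough to
    find them approximately in [A]. *)
Definition near_symbol (e : R) (u v w : C) : Prop :=
  exists u0 v0 w0, [/\ U u0, V v0 & W w0] /\
    [/\ normc (u - u0) <= e, normc (v - v0) <= e & normc (w - w0) <= e].

(** The matching conditions glue [f] and the reflected [g] into a two-sided null vector of the
    operator with primed coefficients in the negative rows. Its truncation, moved to a place where
    [A] nearly has these rows, contradicts [below] unless the two matched values vanish. *)
Lemma no_null_vector (e : R) (u v w u' v' w' : C) (f g : nat -> C) :
  0 < e -> 12 * K * e <= 1 -> near_symbol e u v w -> near_symbol e u' v' w' ->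
  f 0%N = g 1%N -> f 1%N = g 0%N -> vanishing f -> vanishing g ->
  (forall n, u * f n + v * f n.+1 + w * f n.+2 = 0) ->
  (forall n, w' * g n + v' * g n.+1 + u' * g n.+2 = 0) ->
  f 0%N = 0 /\ f 1%N = 0.
Proof.
move=> e0 Ke [u0 [v0 [w0 [[Uu Vv Ww] [eu ev ew]]]]].
move=> [u0' [v0' [w0' [[Uu' Vv' Ww'] [eu' ev' ew']]]]] fg fg' vf vg recf recg.
pose D := normc u + normc v + normc w + normc u' + normc v' + normc w'.
have D0 : 0 <= D by rewrite !addr_ge0 ?normc_ge0.
(* Truncation at height [t] leaves a residual of norm at most [4 D t], and [12 K e <= 1] absorbs
   half of the norm of the truncation; hence the constant [8 K D]. *)
suff H t : 0 < t -> normc (f 0%N) <= 8 * K * D * t /\ normc (f 1%N) <= 8 * K * D * t.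
  have Z (z : R) : 0 <= z -> (forall t, 0 < t -> z <= 8 * K * D * t) -> z = 0.
    move=> z0 Hz; apply/eqP; rewrite eq_le z0 andbT leNgt; apply/negP => zp.
    have q0 : 0 < 8 * K * D + 1 by rewrite ltr_wpDl ?mulr_ge0.
    have := Hz (z / (8 * K * D + 1)) (divr_gt0 zp q0).
    rewrite mulrCA -ler_pdivrMl// mulVf ?gt_eqF// ler_pdivlMr// mul1r; lra.
  by split; apply: Normc.eq0_normc; apply: Z => [|t t0];
    rewrite ?normc_ge0//; have [] := H t t0.
move=> t0.
have [N [N0 HN]] : exists N : nat, (0 < N)%N /\
    forall n, (N <= n.+1)%N -> normc (f n) <= t /\ normc (g n) <= t.
  have [N1 H1] := vf _ t0; have [N2 H2] := vg _ t0.
  exists (N1 + N2).+1; split => // n Hn.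
  by split; [apply: H1|apply: H2]; clear -Hn; lia.
(* Here [x (-1) = f 0 = g 1] and [x 0 = f 1 = g 0]: both formulas hold on this overlap, so every row
   involves only one of the recurrences. *)
pose x (i : int) : C := if 0 <= i then f (absz i).+1 else g (absz i).
have xf i : -1 <= i -> x i = f (absz (i + 1)).
  rewrite /x => i1; case: (leP 0 i) => i0; first by congr f; clear -i0; lia.
  have -> : i = -1 by clear -i0 i1; lia.
  by rewrite /= fg.
have xg i : i <= 0 -> x i = g (absz i).
  rewrite /x => i1; case: (leP 0 i) => // i0.
  have -> : i = 0 by clear -i0 i1; lia.
  exact: fg'.
pose cu (i : int) := if 0 <= i then u else u'.
pose cv (i : int) := if 0 <= i then v else v'.
pose cw (i : int) := if 0 <= i then w else w'.
have Bx i : cu i * x (i - 1) + cv i * x i + cw i * x (i + 1) = 0.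
  rewrite /cu /cv /cw; case: (leP 0 i) => i0.
    rewrite !xf; try by clear -i0; lia.
    have -> : absz (i - 1 + 1) = absz i by clear -i0; lia.
    have -> : absz (i + 1) = (absz i).+1 by clear -i0; lia.
    by have -> : absz (i + 1 + 1) = (absz i).+2 by clear -i0; lia.
  rewrite !xg; try by clear -i0; lia.
  have -> : absz (i - 1) = (absz (i + 1)).+2 by clear -i0; lia.
  have -> : absz i = (absz (i + 1)).+1 by clear -i0; lia.
  by rewrite -(recg (absz (i + 1))); ring.
have xt i : N%:Z - 1 <= `|i| -> normc (x i) <= t.
  move=> iN; rewrite /x; case: (leP 0 i) => i0.
    by apply: (HN _ _).1; clear -i0 iN; lia.
  by apply: (HN _ _).2; clear -i0 iN; lia.
(* Pattern position [j] stands for row [j - N - 2], so that [N + 2] is row 0 and [2 N + 3] positions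
   cover all rows meeting the truncation. *)
pose bu (j : nat) := if (N + 2 <= j)%N then u0 else u0'.
pose bv (j : nat) := if (N + 2 <= j)%N then v0 else v0'.
pose bw (j : nat) := if (N + 2 <= j)%N then w0 else w0'.
have [|k0 Hk0] := @patterns e (N.*2 + 3)%N bu bv bw e0.
  by move=> j; rewrite /bu /bv /bw; case: ifP.
pose k := k0 + N%:Z + 2.
have Hk i : `|i| <= N%:Z + 1 -> [/\ normc (al (k + i) - cu i) <= 2 * e,
    normc (be (k + i) - cv i) <= 2 * e & normc (ga (k + i) - cw i) <= 2 * e].
  move=> iN; have [] := Hk0 (absz (i + N%:Z + 2)); first by clear -iN; lia.
  have -> : k0 + (absz (i + N%:Z + 2))%:Z = k + i by rewrite /k; clear -iN; lia.
  have tri2 (a b c : C) : normc (a - b) <= e -> normc (c - b) <= e ->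
      normc (a - c) <= 2 * e.
    move=> h1 h2; rewrite (_ : a - c = (a - b) + - (c - b)); last by ring.
    by apply: le_trans (le_normcD _ _) _; rewrite normcN; lra.
  rewrite /cu /cv /cw /bu /bv /bw; case: (leP 0 i) => i0.
    rewrite (_ : (N + 2 <= _)%N); last by clear -i0 iN; lia.
    by move=> h1 h2 h3; split; [exact: tri2 h1 eu|exact: tri2 h2 ev|exact: tri2 h3 ew].
  rewrite (_ : (N + 2 <= _)%N = false); last by clear -i0 iN; lia.
  by move=> h1 h2 h3; split; [exact: tri2 h1 eu'|exact: tri2 h2 ev'|exact: tri2 h3 ew'].
pose X (i : int) : C := if `|i - k| <= N%:Z then x (i - k) else 0.
have sX : supported (k - N%:Z) (k + N%:Z) X.
  by move=> i ni; rewrite /X; case: ifPn => // h; exfalso; clear -h ni; lia.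
have Xp := ell_supported p1 sX.
pose Y := tri (fun i => cu (i - k)) (fun i => cv (i - k)) (fun i => cw (i - k)) 0 X.
have [gp ng] : ell p (fun i => tri al be ga 0 X i - Y i) /\
    nrm (fun i => tri al be ga 0 X i - Y i) <= 3 * (2 * e) * nrm X.
  apply: (nrm_dom3 p1 (s := 0)) => // [|i]; first by rewrite mulr_ge0// ltW.
  have [iN|iN] := leP `|i - k| (N%:Z + 1).
    have [] := Hk _ iN; have -> : k + (i - k) = i by ring.
    move=> h1 h2 h3.
    rewrite (_ : _ - Y i = (al i - cu (i - k)) * X (i + 0 - 1) +
      (be i - cv (i - k)) * X (i + 0) + (ga i - cw (i - k)) * X (i + 0 + 1)); last first.
      by rewrite /Y /tri !addr0; ring.
    apply: le_trans (le_normcD _ _) _.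
    apply: le_trans (lerD (le_normcD _ _) (lexx _)) _.
    by rewrite !Normc.normcM !mulrDr !lerD// ler_wpM2r// normc_ge0.
  rewrite /Y /tri !sX ?mulr0 ?addr0 ?subr0 ?Normc.normc0; try by clear -iN; lia.
  by rewrite !addr0 mulr0.
(* A row of the model operator vanishes if its three entries all survive the truncation or are all
   removed. Four rows remain, two at each end. *)
have Yb' i : Y i = 0 \/ N%:Z <= `|i - k| <= N%:Z + 1.
  have [iN|iN] := leP `|i - k| (N%:Z - 1).
    left; rewrite /Y /tri addr0 /X.
    rewrite (_ : `|i - 1 - k| <= N%:Z); last by clear -iN; lia.
    rewrite (_ : `|i - k| <= N%:Z); last by clear -iN; lia.
    rewrite (_ : `|i + 1 - k| <= N%:Z); last by clear -iN; lia.
    have -> : i - 1 - k = i - k - 1 by ring.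
    have -> : i + 1 - k = i - k + 1 by ring.
    exact: Bx.
  have [iN2|iN2] := leP `|i - k| (N%:Z + 1); first by right; clear -iN; lia.
  by left; rewrite /Y /tri addr0 !sX ?mulr0 ?addr0//; clear -iN2; lia.
have Yb i : N%:Z <= `|i - k| <= N%:Z + 1 -> normc (Y i) <= D * t.
  move=> iN.
  have Xt j : `|j - i| <= 1 -> normc (X j) <= t.
    move=> ji; rewrite /X; case: ifP => _; last by rewrite Normc.normc0 ltW.
    by apply: xt; clear -ji iN; lia.
  rewrite /Y /tri addr0; apply: le_trans (le_normcD _ _) _.
  apply: le_trans (lerD (le_normcD _ _) (lexx _)) _; rewrite !Normc.normcM.
  have hh (a b : C) : normc b <= t -> normc a * normc b <= normc a * t.
    by move=> bt; rewrite ler_wpM2l ?normc_ge0.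
  apply: le_trans (lerD (lerD (hh _ _ (Xt _ _)) (hh _ _ (Xt _ _))) (hh _ _ (Xt _ _))) _;
    try by clear; lia.
  rewrite -!mulrDl; apply: ler_wpM2r; first exact: ltW.
  rewrite /D /cu /cv /cw.
  have := @normc_ge0 R u; have := @normc_ge0 R v; have := @normc_ge0 R w.
  have := @normc_ge0 R u'; have := @normc_ge0 R v'; have := @normc_ge0 R w'.
  by case: (0 <= i - k); lra.
pose dl j i : C := if i == j then Y j else 0.
have Y4 : Y = fun i => (dl (k - N%:Z - 1) i + dl (k - N%:Z) i) +
                       (dl (k + N%:Z) i + dl (k + N%:Z + 1) i).
  apply/funext => i; rewrite /dl.
  have [i1|i1] := eqVneq i (k - N%:Z - 1).
    by subst i; rewrite !ifN_eq ?addr0//; clear -N0; lia.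
  have [i2|i2] := eqVneq i (k - N%:Z).
    by subst i; rewrite !ifN_eq ?addr0 ?add0r//; clear -N0; lia.
  have [i3|i3] := eqVneq i (k + N%:Z).
    by subst i; rewrite !ifN_eq ?addr0 ?add0r//; clear -N0; lia.
  have [i4|i4] := eqVneq i (k + N%:Z + 1); first by subst i; rewrite !add0r.
  rewrite !addr0; have [//|] := Yb' i.
  by clear -i1 i2 i3 i4; lia.
have nY : nrm Y <= 4 * (D * t).
  have dp j : ell p (dl j) by exact: ell_delta.
  have nd j : nrm (dl j) <= D * t.
    rewrite nrm_delta//; case: (Yb' j) => [->|]; last exact: Yb.
    by rewrite Normc.normc0 mulr_ge0// ltW.
  rewrite {1}Y4; apply: le_trans (nrmD p1 (ellD p1 (dp _) (dp _)) (ellD p1 (dp _) (dp _))) _.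
  have h1 := nrmD p1 (dp (k - N%:Z - 1)) (dp (k - N%:Z)).
  have h2 := nrmD p1 (dp (k + N%:Z)) (dp (k + N%:Z + 1)).
  have := nd (k - N%:Z - 1); have := nd (k - N%:Z).
  have := nd (k + N%:Z); have := nd (k + N%:Z + 1); lra.
have Yp : ell p Y by apply: (ell_tri_supported p1 _ _ _ _ sX); rewrite normr0.
have XX : nrm X <= 8 * K * D * t.
  have := below Xp.
  have : nrm (tri al be ga 0 X) <= 6 * e * nrm X + 4 * (D * t).
    rewrite (_ : tri al be ga 0 X = fun i => (tri al be ga 0 X i - Y i) + Y i).
      apply: le_trans (nrmD p1 gp Yp) _; lra.
    by apply/funext => i; rewrite subrK.
  move=> /(ler_wpM2l K0) h1 h2.
  have : 12 * K * e * nrm X <= 1 * nrm X by rewrite ler_wpM2r// nrm_ge0.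
  lra.
split; apply: le_trans XX.
  have := normc_le_nrm p1 (k - 1) Xp; rewrite /X (_ : k - 1 - k = -1); last by ring.
  rewrite (_ : `| -1 | <= N%:Z); last by clear -N0; lia.
  by rewrite xf.
have := normc_le_nrm p1 k Xp; rewrite /X subrr normr0.
by rewrite (_ : 0 <= N%:Z).
Qed.

Variable e : R.
Hypothesis e0 : 0 < e.
Hypothesis Ke : 24 * K * e <= 1.

(** A small change of the factors costs another [e], which accounts for the constant 24 in place of
    12. *)
Lemma near_symbol_perturb a b c d u v w : near_symbol e u v w -> factors u v w a b c d ->
  exists2 t : R, 0 < t & forall a' b' c' d',
    normc (a' - a) <= t -> normc (b' - b) <= t ->
    normc (c' - c) <= t -> normc (d' - d) <= t ->
  near_symbol (2 * e) (b' * d') (a' * d' + b' * c') (a' * c').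
Proof.
move=> [u0 [v0 [w0 [M0 [eu ev ew]]]]] [Eu Ev Ew].
have [t t0 Ht] := symbol_continuous a b c d e0.
exists t => // a' b' c' d' ha hb hc hd; exists u0, v0, w0; split => //.
have [h1 h2 h3] := Ht _ _ _ _ ha hb hc hd.
have tri2 (x y z : C) : normc (x - y) <= e -> normc (y - z) <= e ->
    normc (x - z) <= 2 * e.
  move=> xy yz; rewrite (_ : x - z = (x - y) + (y - z)); last by ring.
  by apply: le_trans (le_normcD _ _) _; lra.
by rewrite -Eu in h1; rewrite -Ev in h2; rewrite -Ew in h3; split;
  [exact: tri2 h1 eu|exact: tri2 h2 ev|exact: tri2 h3 ew].
Qed.

Lemma perturb0 (x : C) (t : R) : 0 < t -> normc (x - x) <= t.
Proof. by move=> t0; rewrite subrr Normc.normc0 ltW. Qed.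

Lemma Ke2 : 12 * K * (2 * e) <= 1.
Proof. by move: Ke; lra. Qed.

(** After making the inequalities strict, one zero inside gives a solution decaying to the right
    with value 1 at index 0. Two zeros outside make every solution decay to the left, so it can be
    continued there to a null vector. *)
Lemma not_out2_in1 u v w u' v' w' : near_symbol e u v w -> near_symbol e u' v' w' ->
  out2 u' v' w' -> in1 u v w -> False.
Proof.
move=> N N' [a' [b' [c' [d' [F' ab cd]]]]] [a [b [c [d [F dc]]]]].
have [t t0 Ht] := near_symbol_perturb N F.
have [t' t0' Ht'] := near_symbol_perturb N' F'.
have [b2 ab2 hb] := normc_perturb t0' ab.
have [d2 cd2 hd] := normc_perturb t0' cd.
have [c2 dc2 hc] := normc_perturb t0 dc.
have [f [f0 vf rf]] := decaying_solution1 a b dc2.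
have [g [g0 g1 vg rg]] := decaying_solution2 (f 1%N) (f 0%N) ab2 cd2.
have N2 := Ht a b c2 d (perturb0 _ t0) (perturb0 _ t0) hc (perturb0 _ t0).
have N2' := Ht' a' b2 c' d2 (perturb0 _ t0') hb (perturb0 _ t0') hd.
have e2 : 0 < 2 * e by rewrite mulr_gt0.
have [] := no_null_vector e2 Ke2 N2 N2' (esym g1) (esym g0)
  vf vg rf _.
  by move=> n; rewrite [a' * d2 + b2 * c']addrC rg.
by rewrite f0 => /eqP; rewrite oner_eq0.
Qed.

(** The mirror image: a solution decaying to the left is prescribed, and the right half-axis accepts
    any initial values. *)
Lemma not_out1_in2 u v w u' v' w' : near_symbol e u v w -> near_symbol e u' v' w' ->
  out1 u' v' w' -> in2 u v w -> False.
Proof.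
move=> N N' [a' [b' [c' [d' [F' cd]]]]] [a [b [c [d [F ba dc]]]]].
have [t t0 Ht] := near_symbol_perturb N F.
have [t' t0' Ht'] := near_symbol_perturb N' F'.
have [d2 cd2 hd] := normc_perturb t0' cd.
have [a2 ba2 ha] := normc_perturb t0 ba.
have [c2 dc2 hc] := normc_perturb t0 dc.
have [g [g0 vg rg]] := decaying_solution1 b' a' cd2.
have [f [f0 f1 vf rf]] := decaying_solution2 (g 1%N) (g 0%N) ba2 dc2.
have N2 := Ht a2 b c2 d ha (perturb0 _ t0) hc (perturb0 _ t0).
have N2' := Ht' a' b' c' d2 (perturb0 _ t0') (perturb0 _ t0') (perturb0 _ t0') hd.
have e2 : 0 < 2 * e by rewrite mulr_gt0.
have [] := no_null_vector e2 Ke2 N2 N2' f0 f1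
  vf vg rf _.
  by move=> n; rewrite [a' * d2 + b' * c']addrC rg.
by move=> _; rewrite f1 g0 => /eqP; rewrite oner_eq0.
Qed.

Lemma near_mem u v w : U u -> V v -> W w -> near_symbol e u v w.
Proof.
by move=> Uu Vv Ww; exists u, v, w; split => //; split; exact: perturb0.
Qed.

Lemma Delta_neq0 u v w : U u -> V v -> W w -> Delta u v w != 0.
Proof.
move=> Uu Vv Ww; have N := near_mem Uu Vv Ww.
apply/eqP => /zero_Delta[[h i]|[h i]].
  exact: (not_out2_in1 N N h i).
exact: (not_out1_in2 N N h i).
Qed.

Lemma case_incompatible u v w u' v' w' : U u -> V v -> W w ->
  U u' -> V v' -> W w' ->
  [/\ ~ (case_a u v w /\ case_b u' v' w'),
      ~ (case_a u v w /\ case_c u' v' w') &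
      ~ (case_b u v w /\ case_c u' v' w')].
Proof.
move=> Uu Vv Ww Uu' Vv' Ww'.
have N := near_mem Uu Vv Ww; have N' := near_mem Uu' Vv' Ww'.
split=> -[].
- move=> /case_a_in1_out1[i1 _] /case_b_out2 o2.
  exact: (not_out2_in1 N N' o2 i1).
- move=> /case_a_in1_out1[_ o1] /case_c_in2 i2.
  exact: (not_out1_in2 N' N o1 i2).
- move=> /case_b_out2 o2 /case_c_in2 /in2_in1 i1.
  exact: (not_out2_in1 N' N o2 i1).
Qed.

(** If [|w'| < e], the triple [(u, v, 0)] is near [U x V x W]; its zero at infinity is incompatible
    with the two inner zeros of case (c). This supplies the lower bound needed by
    [left_corner_down]. *)
Lemma case_c_lower u v w w' : U u -> V v -> W w -> W w' -> case_c u v w ->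
  e <= normc w'.
Proof.
move=> Uu Vv Ww Ww' /case_c_in2 i2; rewrite leNgt; apply/negP => we.
have N := near_mem Uu Vv Ww.
have N' : near_symbol e u v 0.
  exists u, v, w'; split => //; split; rewrite ?perturb0//.
  by rewrite sub0r normcN ltW.
apply: (not_out1_in2 N N') => //; exists v, u, 0, 1; split.
  by split; ring.
by rewrite Normc.normc0 Normc.normc1.
Qed.

(** The same with [(0, v, w)], whose symbol vanishes at the origin. *)
Lemma case_b_lower u v w u' : U u -> V v -> W w -> U u' -> case_b u v w ->
  e <= normc u'.
Proof.
move=> Uu Vv Ww Uu' /case_b_out2 o2; rewrite leNgt; apply/negP => we.
have N := near_mem Uu Vv Ww.
have N' : near_symbol e 0 v w.
  exists u', v, w; split => //; split; rewrite ?perturb0//.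
  by rewrite sub0r normcN ltW.
apply: (not_out2_in1 N' N) => //; exists w, v, 1, 0; split.
  by split; ring.
by rewrite Normc.normc0 Normc.normc1.
Qed.

End NoNullVector.

(** * Convergence of the finite section method *)

Section WindowSolve.
Variables (R : realType) (T : (int -> R[i]) -> int -> R[i]) (l : int) (n : nat).
Local Notation C := R[i].
Hypothesis Tlin : forall (a : C) x y,
  T (fun i => a * x i + y i) = fun i => a * T x i + T y i.

Definition window_ext (v : 'rV[C]_n.+1) : int -> C :=
  fun i => if l <= i <= l + n%:Z then v 0 (inord (absz (i - l))) else 0.

Definition window_map (v : 'rV[C]_n.+1) : 'rV[C]_n.+1 :=
  \row_j T (window_ext v) (l + (j : nat)%:Z).

Lemma window_map_linear : linear window_map.
Proof.
move=> a v w; apply/rowP => j; rewrite !mxE.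
have -> : window_ext (a *: v + w) =
    fun i => a * window_ext v i + window_ext w i.
  apply/funext => i; rewrite /window_ext; case: ifP => _; first by rewrite !mxE.
  by rewrite mulr0 addr0.
by rewrite Tlin.
Qed.

HB.instance Definition _ := GRing.isLinear.Build C 'rV[C]_n.+1 'rV[C]_n.+1 _
  window_map window_map_linear.

(** Existence from uniqueness: on row vectors of length [n + 1] the section is a square matrix with
    trivial kernel. *)
Lemma window_solve (c : int -> C) :
  (forall y, supported l (l + n%:Z) y -> cutP l (l + n%:Z) (T y) = (fun=> 0) ->
     y = fun=> 0) ->
  exists2 y, supported l (l + n%:Z) y &
    cutP l (l + n%:Z) (T y) = cutP l (l + n%:Z) c.
Proof.
move=> inj; pose F := lin1_mx window_map.
have cutE v i (j : 'I_n.+1) : i = l + (j : nat)%:Z ->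
    cutP l (l + n%:Z) (T (window_ext v)) i = window_map v 0 j.
  move=> ->; rewrite /window_map mxE /cutP ifT//.
  by have := ltn_ord j; lia.
have sext v : supported l (l + n%:Z) (window_ext v).
  by move=> i ni; rewrite /window_ext (negbTE ni).
have idx i : l <= i <= l + n%:Z -> exists j : 'I_n.+1, i = l + (j : nat)%:Z.
  move=> hi; have h : (absz (i - l) < n.+1)%N by lia.
  by exists (Ordinal h) => /=; lia.
have Fu : F \in unitmx.
  rewrite -row_free_unit -kermx_eq0; apply/rowV0P => v /sub_kermxP.
  rewrite mul_rV_lin1 /= => v0.
  have ext0 : window_ext v = fun=> 0.
    apply: inj => //; apply/funext => i.
    have [hi|hi] := boolP (l <= i <= l + n%:Z).
      by have [j ij] := idx _ hi; rewrite (cutE _ _ _ ij) v0 mxE.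
    by rewrite /cutP (negbTE hi).
  apply/rowP => j; have := congr1 (fun f => f (l + (j : nat)%:Z)) ext0.
  rewrite /window_ext ifT; last by have := ltn_ord j; lia.
  have -> : absz (l + (j : nat)%:Z - l)%R = j by clear; lia.
  by rewrite inord_val mxE.
exists (window_ext ((\row_j c (l + (j : nat)%:Z)) *m invmx F)) => //.
apply/funext => i; have [hi|hi] := boolP (l <= i <= l + n%:Z); last first.
  by rewrite /cutP (negbTE hi).
have [j ij] := idx _ hi; rewrite (cutE _ _ _ ij).
have -> : forall v, window_map v = v *m F by move=> v; rewrite mul_rV_lin1.
by rewrite mulmxKV// mxE /cutP hi ij.
Qed.

End WindowSolve.

Section Convergence.
Variables (R : realType) (p : \bar R).
Hypothesis p1 : (1 <= p)%E.
Local Notation C := R[i].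
Local Notation normc := Normc.normc.
Local Notation nrm := (nrm p).
Implicit Types (x y z f h al be ga : int -> C) (k s : int) (u v w : C).

Lemma nrm0 : nrm (fun=> 0) = 0.
Proof.
rewrite -(@Normc.normc0 R) -(nrm_delta p1 0 0); congr nrm.
by apply/funext => i; case: eqP.
Qed.

Lemma cvg_normc (xs : nat -> C) (x : C) :
  (forall e : R, 0 < e -> \forall n \near \oo, normc (xs n - x) <= e) ->
  (xs n : C^o) @[n --> \oo] --> (x : C^o).
Proof.
move=> H; apply/cvgrPdist_le => /= e.
(* The radius is an element of [R[i]]; being positive in its partial order, it is real. *)
rewrite ltcE /= => /andP[/eqP e0 e1].
have := H _ e1; apply: filterS => n hn.
rewrite -normrN opprB normc_def.
have -> : e = (complex.Re e)%:C%C by case: e e0 {e1 hn} => a b /= ->.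
rewrite lecR; move: hn; rewrite /Normc.normc.
by case: (xs n - x).
Qed.

Lemma tri_linear al be ga s (a : C) x y :
  tri al be ga s (fun i => a * x i + y i) =
  fun i => a * tri al be ga s x i + tri al be ga s y i.
Proof. by apply/funext => i; rewrite /tri; ring. Qed.

Lemma range_cutP (l r : int) y : range (cutP l r) y <-> supported l r y.
Proof.
split=> [[x _ <-] i ni|sy]; first by rewrite /cutP (negbTE ni).
exists y => //; apply/funext => i; rewrite /cutP.
by case: ifPn => // ni; rewrite sy.
Qed.

Lemma cutP_supported (l r : int) y : supported l r y -> cutP l r y = y.
Proof.
move=> sy; apply/funext => i; rewrite /cutP.
by case: ifPn => // ni; rewrite sy.
Qed.

Variables (al be ga : int -> C) (s : int) (M K : R).
Hypothesis s1 : `|s| <= 1.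
Hypothesis bd :
  forall i, normc (al i) <= M /\ normc (be i) <= M /\ normc (ga i) <= M.
Local Notation T := (tri al be ga s).
Hypothesis K0 : 0 <= K.
Hypothesis below : forall x, ell p x -> nrm x <= K * nrm (T x).

(** Stability gives uniqueness, hence solvability, and boundedness. The difference of [xs n] and the
    truncated [x] is annihilated by all rows away from the cut-offs, so [local_bound] makes it small
    at each fixed index. *)
Lemma fsm_converges u v w (kappa : R) (l r : nat -> int) x : 0 < kappa ->
  left_corner p al be ga s u v w kappa ->
  left_corner p (ga \o -%R) (be \o -%R) (al \o -%R) (- s) w v u kappa ->
  (forall k : int, \forall n \near \oo, l n <= k) ->
  (forall k : int, \forall n \near \oo, k <= r n) ->
  (forall n : nat, (1 <= n)%N -> forall i : int,
     (l n <= i <= l n + n%:Z) || (r n - n%:Z <= i <= r n) ->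
     close al be ga u v w n%:R^-1 i) ->
  ell p x ->
  exists xs : nat -> int -> C,
    [/\ \forall n \near \oo,
          finite_section_solution T (l n) (r n) (T x) (xs n) /\
          (forall y, finite_section_solution T (l n) (r n) (T x) y -> y = xs n),
        exists B : R, \forall n \near \oo, (lpnorm p (xs n) <= B%:E)%E &
        forall i, (xs n i : C^o) @[n --> \oo] --> (x i : C^o)].
Proof.
move=> kap0 lc rc linf rinf cl xp.
have [K' [m0 [K'0 m00 st]]] := stability p1 s1 bd K0 below kap0 lc rc.
have [Txp _] := ell_tri p1 s bd xp.
(* For [n >= m0] the windows at level [n] are longer and their tolerance is smaller than required at
   level [m0]. *)
pose good n := (m0 <= n)%N /\ l n + m0%:Z <= r n.
have goodE : \forall n \near \oo, good n.
  near=> n; split; first by near: n; exists m0.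
  apply: (@le_trans _ _ 0); last by near: n; exact: rinf.
  suff : l n <= - m0%:Z by lia.
  by near: n; exact: linf.
have stable n : good n -> forall y, supported (l n) (r n) y ->
    nrm y <= K' * nrm (cutP (l n) (r n) (T y)).
  move=> [nm lr] y sy; apply: st => // i hi.
  have n0 : (0 < n)%N by exact: leq_trans nm.
  apply: le_trans (cl n n0 i _) _.
    by move: nm hi; clear; lia.
  by rewrite lef_pV2 ?posrE ?ltr0n// ler_nat.
have uniq n : good n -> forall y, supported (l n) (r n) y ->
    cutP (l n) (r n) (T y) = (fun=> 0) -> y = fun=> 0.
  move=> gn y sy c0; apply: (nrm_eq0 p1 (ell_supported p1 sy)).
  by apply: le_trans (stable n gn y sy) _; rewrite c0 nrm0 mulr0.
have sol n : exists y, good n -> supported (l n) (r n) y /\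
    cutP (l n) (r n) (T y) = cutP (l n) (r n) (T x).
  have [gn|ngn] := pselect (good n); last by exists x => /ngn.
  have lr : l n <= r n by case: gn => _; clear; lia.
  have rE : r n = l n + (absz (r n - l n))%:Z by lia.
  have [|y sy yE] := @window_solve R T (l n) (absz (r n - l n))
      (tri_linear al be ga s) (T x).
    by rewrite -rE; exact: uniq.
  by exists y => _; move: sy yE; rewrite -rE.
have {sol} [xs xsP] := choice sol.
pose B := K' * nrm (T x).
have xsB n : good n -> nrm (xs n) <= B.
  move=> gn; have [sy yE] := xsP n gn.
  apply: le_trans (stable n gn _ sy) _; rewrite yE ler_wpM2l//.
  exact: (ell_cutP p1 _ _ Txp).2.
exists xs; split.
- apply: filterS goodE => n gn; have [sy yE] := xsP n gn.
  split; first by split; [exact/range_cutP|rewrite (cutP_supported sy)].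
  move=> y [/range_cutP sy']; rewrite (cutP_supported sy') => yE'.
  have sz : supported (l n) (r n) (fun i => (-1) * xs n i + y i).
    by move=> i ni; rewrite sy// sy'// mulr0 addr0.
  have : (fun i => (-1) * xs n i + y i) = fun=> 0.
    apply: (uniq n gn _ sz); rewrite tri_linear; apply/funext => i.
    have := congr1 (fun f => f i) yE; have := congr1 (fun f => f i) yE'.
    rewrite /cutP; case: ifP => // _ -> ->; ring.
  move=> e; apply/funext => i; have := congr1 (fun f => f i) e.
  by rewrite /= mulN1r addrC => /eqP; rewrite subr_eq0 => /eqP.
- exists B; apply: filterS goodE => n gn; have [sy _] := xsP n gn.
  by rewrite lpnormE ?lee_fin ?xsB//; exact: (ell_supported p1 sy).
move=> k; apply: cvg_normc => e e0.
have M0 : 0 <= M by have := normc_ge0 (al 0); have [+ _] := bd 0; lra.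
pose Q := 12 * K * M * (B + nrm x).
have Bx0 : 0 <= B + nrm x by rewrite addr_ge0 ?nrm_ge0// mulr_ge0 ?nrm_ge0.
have [N NQ] : exists N : nat, Q / e + 1 < N%:R.
  by exists (Num.trunc (Q / e + 1)).+1; exact: truncnS_gt.
have Q0 : 0 <= Q by rewrite !mulr_ge0.
have Qe0 : 0 <= Q / e by rewrite divr_ge0// ltW.
have N0 : (0 < N)%N by rewrite -(ltr_nat R); lra.
near=> n.
have gn : good n by near: n.
have ln : l n <= k - N%:Z - 3 by near: n; exact: linf.
have rn : k + N%:Z + 3 <= r n by near: n; exact: rinf.
have [sy yE] := xsP n gn.
(* The coefficient -1 matches the form [a * x + y] of [tri_linear]. The margin 3 in [ln] and [rn]
   keeps the rows around [k] from seeing the truncation of [x]. *)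
pose z i := (-1) * cutP (l n) (r n) x i + xs n i.
have sc : supported (l n) (r n) (cutP (l n) (r n) x).
  by move=> i ni; rewrite /cutP (negbTE ni).
have sz : supported (l n) (r n) z.
  by move=> i ni; rewrite /z sc// sy// mulr0 addr0.
have zk : z k = xs n k - x k.
  rewrite /z /cutP ifT; first by rewrite mulN1r addrC.
  by move: ln rn; clear; lia.
have Tz i : k - N%:Z <= i <= k + N%:Z -> T z i = 0.
  move=> hi; rewrite /z tri_linear.
  have := congr1 (fun f => f i) yE; rewrite /cutP ifT; last first.
    by move: hi ln rn; clear; lia.
  move=> ->; rewrite /tri /cutP !ifT; try ring;
    by move: hi ln rn s1; clear; lia.
suff : normc (z k) <= e by rewrite zk.
apply: le_trans (local_bound p1 s1 bd K0 below N0 sz _ _ Tz) _.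
- by move: ln; clear; lia.
- by move: rn; clear; lia.
have zB : nrm z <= B + nrm x.
  have [cp nc] := ell_cutP p1 (l n) (r n) xp.
  apply: le_trans (nrmD p1 (ellZ p1 (-1) cp) (ell_supported p1 sy)) _.
  rewrite nrmZ// normcN Normc.normc1 mul1r; have := xsB n gn; lra.
have NR : 0 < N%:R :> R by rewrite ltr0n.
apply: (@le_trans _ _ (12 * K * M / N%:R * (B + nrm x))).
  by rewrite ler_wpM2l// divr_ge0// !mulr_ge0.
rewrite mulrAC ler_pdivrMr// -/Q mulrC -ler_pdivrMr//; lra.
Unshelve. all: by end_near.
Qed.

End Convergence.

(** Recursive choice: each value is taken beyond its predecessor and beyond its own index, which
    yields monotonicity and divergence together. *)
Lemma monotone_selection (P : nat -> int -> Prop) :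
  (forall n (k : int), exists2 m, k <= m & P n m) ->
  exists r : nat -> int, forall n, [/\ P n (r n), n%:Z <= r n & r n <= r n.+1].
Proof.
move=> H.
have [g gP] := choice (fun nk : nat * int =>
  let: ex_intro2 m h1 h2 := H nk.1 nk.2 in
  ex_intro (fun m => nk.2 <= m /\ P nk.1 m) m (conj h1 h2)).
pose r := fix r n := if n is m.+1 then g (n, Num.max (r m) n%:Z) else g (0%N, 0).
exists r; case=> [|n] /=.
  have [h1 h2] := gP (0%N, 0); have [h3 h4] := gP (1%N, Num.max (g (0%N, 0)) 1%:Z).
  by split => //; move: h3; rewrite ge_max => /andP[].
set q := Num.max (r n) n.+1%:Z; have [/= h1 h2] := gP (n.+1, q).
set q' := Num.max _ n.+2%:Z; have [/= h3 h4] := gP (n.+2, q').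
move: h1; rewrite {1}/q ge_max => /andP[_ h1].
by split => //; move: h3; rewrite {1}/q' ge_max => /andP[].
Qed.

(** * From invertible operators to applicability of the method *)

Section Applicability.
Variables (R : realType) (p : \bar R).
Hypothesis p1 : (1 <= p)%E.
Local Notation C := R[i].
Local Notation normc := Normc.normc.
Local Notation nrm := (nrm p).
Implicit Types (T : (int -> C) -> int -> C) (x : int -> C).

Lemma act_tri (U V W : set C) A : tridiagonal U V W A ->
  act A = tri (fun i => A i (i - 1)) (fun i => A i i) (fun i => A i (i + 1)) 0.
Proof.
move=> [_ A0]; apply/funext => x; apply/funext => i; rewrite /act /tri addr0.
rewrite (fsbigE [:: i - 1; i; i + 1])//.
- rewrite !big_cons big_nil !in_setT /=.
  by rewrite addr0 !addrA.
- by rewrite /= !inE; clear; lia.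
- move=> j _ jn; rewrite A0 ?mul0r//; move: jn; rewrite !inE; clear; lia.
Qed.

Lemma bounded_op_shift T s :
  bounded_op p T -> bounded_op p (fun x i => T x (i + s)).
Proof.
move=> [T1 T2 [K T3]]; split.
- by move=> x xp; apply: (ell_shift p1 s); exact: T1.
- by move=> a x y xp yp; rewrite T2.
- by exists K => x xp; rewrite (lpnorm_shift p1 (T x)); exact: T3.
Qed.

Lemma invertible_op_shift T s :
  invertible_op p T -> invertible_op p (fun x i => T x (i + s)).
Proof.
move=> [bT [B [B1 B2 [K B3]] TB]]; split; first exact: bounded_op_shift.
have sp x : ell p x -> ell p (fun i => x (i - s)) := ell_shift p1 (- s).
exists (fun x => B (fun i => x (i - s))).
  split.
  - by move=> x xp; apply: B1; exact: sp.
  - by move=> a x y xp yp; rewrite B2//; exact: sp.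
  - exists K => x xp; apply: le_trans (B3 _ (sp _ xp)) _.
    by rewrite (lpnorm_shift p1 x).
move=> x xp; split.
  have [-> _] := TB _ (sp _ xp); apply/funext => i; by rewrite addrK.
rewrite (_ : (fun i => T x (i - s + s)) = T x); last first.
  by apply/funext => i; rewrite subrK.
by have [_ ->] := TB _ xp.
Qed.

Lemma invertible_op_below T : invertible_op p T ->
  exists2 K : R, 0 <= K & forall x, ell p x -> nrm x <= K * nrm (T x).
Proof.
move=> [[T1 _ _] [B [B1 _ [K B3]] TB]]; exists `|K| => // x xp.
have [_ e] := TB _ xp; rewrite -{1}e.
have Txp := T1 _ xp.
have := B3 _ Txp; rewrite (lpnormE (B1 _ Txp)) (lpnormE Txp) -EFinM lee_fin.
move=> h; apply: le_trans h _; apply: ler_wpM2r; first exact: nrm_ge0.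
exact: ler_norm.
Qed.

(** Every entry is a component of the image of a unit vector. *)
Lemma entries_bounded al be ga : bounded_op p (tri al be ga 0) ->
  exists M : R, forall i, normc (al i) <= M /\ normc (be i) <= M /\ normc (ga i) <= M.
Proof.
move=> [T1 _ [K TK]]; exists K.
pose delta (k i : int) : C := if i == k then 1 else 0.
have H k i : normc (tri al be ga 0 (delta k) i) <= K.
  have dp : ell p (delta k) by exact: ell_delta.
  apply: le_trans (normc_le_nrm p1 i (T1 _ dp)) _.
  have := TK _ dp; rewrite (lpnormE dp) (lpnormE (T1 _ dp)) -EFinM lee_fin.
  by rewrite /delta nrm_delta// Normc.normc1 mulr1.
move=> i; split; last split.
- have := H (i - 1) i; rewrite /tri /delta addr0 eqxx !ifN_eq; try by clear; lia.
  by rewrite !mulr0 !addr0 mulr1.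
- have := H i i; rewrite /tri /delta addr0 eqxx !ifN_eq; try by clear; lia.
  by rewrite !mulr0 addr0 add0r mulr1.
- have := H (i + 1) i; rewrite /tri /delta addr0 eqxx !ifN_eq; try by clear; lia.
  by rewrite !mulr0 !add0r mulr1.
Qed.

Lemma left_corner_le al be ga s u v w (k1 k2 : R) : k1 <= k2 ->
  left_corner p al be ga s u v w k2 -> left_corner p al be ga s u v w k1.
Proof.
move=> k12 lc l e m y e0 cl sy; apply: le_trans (lc l e m y e0 cl sy).
by rewrite ler_wpM2r// nrm_ge0.
Qed.

Lemma fsm_applicable_corners T al be ga s (M : R) u v w (k1 k2 : R)
    (l r : nat -> int) (c : int -> C) :
  T = tri al be ga s -> `|s| <= 1 ->
  (forall i, normc (al i) <= M /\ normc (be i) <= M /\ normc (ga i) <= M) ->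
  invertible_op p T -> 0 < k1 -> 0 < k2 ->
  left_corner p al be ga s u v w k1 ->
  left_corner p (ga \o -%R) (be \o -%R) (al \o -%R) (- s) w v u k2 ->
  (forall k : int, \forall n \near \oo, l n <= k) ->
  (forall k : int, \forall n \near \oo, k <= r n) ->
  (forall n : nat, (1 <= n)%N -> forall i : int,
     (l n <= i <= l n + n%:Z) || (r n - n%:Z <= i <= r n) ->
     close al be ga u v w n%:R^-1 i) ->
  ell p c -> fsm_applicable p T c l r.
Proof.
move=> TE s1 bd iT k10 k20 lc rc linf rinf cl cp.
have [K K0] := invertible_op_below iT; rewrite TE => below.
have [_ [B [B1 _ _] TB]] := iT.
have [e _] := TB _ cp.
have kap0 : 0 < Num.min k1 k2 by rewrite lt_min k10 k20.
have lc' : left_corner p al be ga s u v w (Num.min k1 k2).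
  by apply: left_corner_le lc; rewrite ge_min lexx.
have rc' : left_corner p (ga \o -%R) (be \o -%R) (al \o -%R) (- s) w v u (Num.min k1 k2).
  by apply: left_corner_le rc; rewrite ge_min lexx orbT.
have [xs [X1 X2 X3]] := fsm_converges p1 s1 bd K0 below kap0 lc' rc' linf rinf cl
  (B1 _ cp).
rewrite -TE e in X1 *.
split => //; exists xs; split => //; exists (B c); split => //.
exact: B1.
Qed.

Lemma normc_le_dist3 (x y : C * C * C) :
  [/\ normc (x.1.1 - y.1.1) <= dist3 x y, normc (x.1.2 - y.1.2) <= dist3 x y &
      normc (x.2 - y.2) <= dist3 x y].
Proof.
have S (t : C) (q : R) : normc t ^+ 2 <= q -> normc t <= Num.sqrt q.
  move=> tq; rewrite -(ger0_norm (normc_ge0 t)) -sqrtr_sqr.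
  exact: ler_wsqrtr.
have := sqr_ge0 (normc (x.1.1 - y.1.1)); have := sqr_ge0 (normc (x.1.2 - y.1.2)).
have := sqr_ge0 (normc (x.2 - y.2)) => h3 h2 h1.
by split; apply: S; lra.
Qed.

End Applicability.

(** * Finite patterns and the existence of cut-off sequences *)

Section Cutoffs.
Variables (R : realType) (U V W : set R[i]) (A : int -> int -> R[i]).
Hypothesis PA : PsiE2 U V W A.
Local Notation C := R[i].
Local Notation normc := Normc.normc.

Lemma patterns (e : R) (n : nat) (bu bv bw : nat -> C) : 0 < e ->
  (forall i, U (bu i) /\ V (bv i) /\ W (bw i)) ->
  exists k : int, forall i : nat, (1 <= i <= n)%N ->
    [/\ normc (A (k + i%:Z) (k + i%:Z - 1) - bu i) <= e,
        normc (A (k + i%:Z) (k + i%:Z) - bv i) <= e &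
        normc (A (k + i%:Z) (k + i%:Z + 1) - bw i) <= e].
Proof.
move=> e0 H; case: PA => _ [_ P] _.
(* The length [n + 1] keeps the pattern non-empty, as pseudoergodicity requires. *)
have [|i _|k _ Hk] := P e n.+1 (fun i => (bu i, bv i, bw i)) e0 => //.
  by have [? [? ?]] := H i.
exists k => i hi; have [_ d] := Hk i ltac:(by move: hi; clear; lia).
have [h1 h2 h3] := normc_le_dist3 (diags A (k + i%:Z)) (bu i, bv i, bw i).
by split; apply: le_trans (ltW d).
Qed.

Variables u v w : C.
Hypotheses (Uu : U u) (Vv : V v) (Ww : W w).

Definition near_row (e : R) (i : int) : Prop :=
  normc (A i (i - 1) - u) + normc (A i i - v) + normc (A i (i + 1) - w) < e.

Lemma dist3_near_row (n : nat) i :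
  dist3 (diags A i) (u, v, w) < (3 * n.+1%:R)^-1 -> near_row n.+1%:R^-1 i.
Proof.
move=> d; have [/= h1 h2 h3] := normc_le_dist3 (diags A i) (u, v, w).
rewrite /near_row; move: d; rewrite invfM; move: (n.+1%:R^-1) => q d; lra.
Qed.

(** A constant pattern of length [n + |k| + 1] at positive indices necessarily ends beyond [k]; its
    last [n + 1] rows form the window. *)
Lemma right_windows (n : nat) (k : int) : exists2 m, k <= m &
  forall i, m - n%:Z <= i <= m -> near_row n.+1%:R^-1 i.
Proof.
case: PA => _ [_ P] _.
pose N := (n + absz k).+1.
have e0 : 0 < (3 * n.+1%:R)^-1 :> R by rewrite invr_gt0 mulr_gt0 ?ltr0n.
have [|i _|k0 /= k01 Hk] := P _ N (fun=> (u, v, w)) e0 => //.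
exists (k0 + N%:Z); first by move: k01; rewrite /N; clear; lia.
move=> i hi; apply: dist3_near_row.
have hj : (1 <= absz (i - k0) <= N)%N by move: hi; rewrite /N; clear; lia.
have [_] := Hk _ hj.
by rewrite (_ : k0 + (absz (i - k0))%:Z = i)//; move: hi; rewrite /N; clear; lia.
Qed.

(** The mirror image, with [- m] as left end so that [monotone_selection] serves both sides. *)
Lemma left_windows (n : nat) (k : int) : exists2 m, k <= m &
  forall i, - m <= i <= - m + n%:Z -> near_row n.+1%:R^-1 i.
Proof.
case: PA => _ _ [_ P].
pose N := (n + absz k).+1.
have e0 : 0 < (3 * n.+1%:R)^-1 :> R by rewrite invr_gt0 mulr_gt0 ?ltr0n.
have [|i _|k0 /= k01 Hk] := P _ N (fun=> (u, v, w)) e0 => //.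
have [/= k0N _] := Hk N ltac:(by rewrite /N; clear; lia).
exists (- (k0 + 1)); first by move: k0N; rewrite /N; clear; lia.
move=> i hi; apply: dist3_near_row.
have hj : (1 <= absz (i - k0) <= N)%N by move: hi; rewrite /N; clear; lia.
have [_] := Hk _ hj.
by rewrite (_ : k0 + (absz (i - k0))%:Z = i)//; move: hi; rewrite /N; clear; lia.
Qed.

Lemma nat_homo_le (r : nat -> int) : (forall n, r n <= r n.+1) ->
  forall m n, (m <= n)%N -> r m <= r n.
Proof.
move=> rS m n /subnKC <-; elim: (n - m)%N => [|k IH]; first by rewrite addn0.
by rewrite addnS; exact: le_trans IH (rS _).
Qed.

Lemma good_cutoffs_exist : exists l r, good_cutoffs A u v w l r.
Proof.
have [r rP] := monotone_selection right_windows.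
have [l lP] := monotone_selection left_windows.
have mr : forall m n, (m <= n)%N -> r m <= r n.
  by apply: nat_homo_le => n; have [] := rP n.
have ml : forall m n, (m <= n)%N -> l m <= l n.
  by apply: nat_homo_le => n; have [] := lP n.
have rn n : n%:Z <= r n by have [] := rP n.
have ln n : n%:Z <= l n by have [] := lP n.
exists (fun n => - l n), r; split.
- by move=> m n /andP[_ mn]; rewrite lerN2; exact: ml.
- move=> k; exists (absz k) => // n /= kn; have := ln n; move: kn; clear; lia.
- by move=> m n /andP[_ mn]; exact: mr.
- move=> k; exists (absz k) => // n /= kn; have := rn n; move: kn; clear; lia.
case=> // n _; split; first by have := rn n.+1; have := ln n.+1; clear; lia.
have mono e1 e2 i : e1 <= e2 -> near_row e1 i -> near_row e2 i.
  by move=> e12 h; exact: lt_le_trans h e12.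
(* The selection at index [n + 1] has tolerance [1 / (n + 2)], slightly better than needed. *)
have ee : (n.+2%:R)^-1 <= (n.+1%:R)^-1 :> R.
  by rewrite lef_pV2 ?posrE ?ltr0n// ler_nat.
have [rw _ _] := rP n.+1; have [lw _ _] := lP n.+1.
by move=> i /orP[hi|hi]; apply: (mono _ _ _ ee); [exact: lw|exact: rw].
Qed.

End Cutoffs.

(** * Assembly of cut-offs, trichotomy and applicability *)

Theorem mainTheorem3 (R : realType) (U V W : set R[i])
    (U0 : U !=set0) (V0 : V !=set0) (W0 : W !=set0)
    (cU : compact (U : set R[i]^o)) (cV : compact (V : set R[i]^o))
    (cW : compact (W : set R[i]^o))
    (p : \bar R) (p1 : (1 <= p)%E)
    (A : int -> int -> R[i]) (PA : PsiE2 U V W A)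
    (iA : invertible_op p (act A))
    (u v w : R[i]) (Uu : U u) (Vv : V v) (Ww : W w) :
  [/\
    exists l r : nat -> int, good_cutoffs A u v w l r,
    [/\ [\/ case_a u v w, case_b u v w | case_c u v w],
        [/\ ~ (case_a u v w /\ case_b u v w),
            ~ (case_a u v w /\ case_c u v w) &
            ~ (case_b u v w /\ case_c u v w)] &
        forall u' v' w' : R[i], U u' -> V v' -> W w' ->
          [/\ case_a u v w <-> case_a u' v' w',
              case_b u v w <-> case_b u' v' w' &
              case_c u v w <-> case_c u' v' w']] &
    forall l r : nat -> int, good_cutoffs A u v w l r ->
      forall b : int -> R[i], ell p b ->
        [/\ case_a u v w -> fsm_applicable p (act A) b l r,
            case_b u v w ->
              (forall x, ell p x ->
                 act A x = b <-> shiftV (act A x) = shiftV b) /\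
              fsm_applicable p (fun x => shiftV (act A x)) (shiftV b) l r &
            case_c u v w ->
              (forall x, ell p x ->
                 act A x = b <-> shift (act A x) = shift b) /\
              fsm_applicable p (fun x => shift (act A x)) (shift b) l r]].
Proof.
have [tA _ _] := PA; have [rowA _] := tA.
have [K K0 below] := invertible_op_below iA; rewrite (act_tri tA) in below.
have [M bd] : exists M : R, forall i, Normc.normc (A i (i - 1)) <= M /\
    Normc.normc (A i i) <= M /\ Normc.normc (A i (i + 1)) <= M.
  by apply: (entries_bounded p1); rewrite -(act_tri tA); case: iA.
(* The summand 1 keeps [e] positive and finite also for [K = 0]. *)
pose e : R := (24 * K + 1)^-1.
have q0 : 0 < 24 * K + 1 by rewrite ltr_wpDl// mulr_ge0.
have e0 : 0 < e by rewrite invr_gt0.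
have Ke : 24 * K * e <= 1 by rewrite ler_pdivrMr// mul1r lerDl.
have pat := patterns PA.
have D0 u' v' w' := @Delta_neq0 _ _ p1 _ _ _ _ _ _ _ K0 below pat _ e0 Ke u' v' w'.
have incomp := @case_incompatible _ _ p1 _ _ _ _ _ _ _ K0 below pat _ e0 Ke.
split; first exact: (good_cutoffs_exist PA Uu Vv Ww).
  have t3 := Delta_trichotomy (D0 _ _ _ Uu Vv Ww).
  split => //; first exact: incomp.
  move=> u' v' w' Uu' Vv' Ww'.
  have t3' := Delta_trichotomy (D0 _ _ _ Uu' Vv' Ww').
  have [n1 n2 n3] := incomp _ _ _ _ _ _ Uu Vv Ww Uu' Vv' Ww'.
  have [m1 m2 m3] := incomp _ _ _ _ _ _ Uu' Vv' Ww' Uu Vv Ww.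
  clear -t3 t3' n1 n2 n3 m1 m2 m3.
  by split; case: t3 => h; case: t3' => h'; tauto.
move=> l r [_ linf _ rinf clo] b bp.
have cl n : (1 <= n)%N -> forall i : int,
    (l n <= i <= l n + n%:Z) || (r n - n%:Z <= i <= r n) ->
    close (fun i => A i (i - 1)) (fun i => A i i) (fun i => A i (i + 1))
      u v w n%:R^-1 i.
  by move=> n1 i hi; have [_ /(_ i hi)] := clo n n1; exact: ltW.
have triS s : (fun x i => act A x (i + s)) =
    tri (fun i => A i (i - 1)) (fun i => A i i) (fun i => A i (i + 1)) s.
  apply/funext => x; apply/funext => i.
  by rewrite (act_tri tA) /tri !addr0.
split.
(* No shift: the two corners are Wiener-Hopf products, the right one with the reversed factors
   [d, c, b0, a]. *)
- move=> /case_aP[a [b0 [c [d [[uE vE wE] ba cd]]]]].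
  apply: (fsm_applicable_corners p1 (act_tri tA) _ bd iA
    (k1 := (Normc.normc a - Normc.normc b0) * (Normc.normc d - Normc.normc c))
    (k2 := (Normc.normc d - Normc.normc c) * (Normc.normc a - Normc.normc b0))
    (u := u) (v := v) (w := w)) => //.
  + by rewrite mulr_gt0 ?subr_gt0.
  + by rewrite mulr_gt0 ?subr_gt0.
  + by rewrite uE vE wE; exact: left_corner0.
  + have [-> -> ->] := factors_rev (And3 uE vE wE).
    by rewrite oppr0; exact: left_corner0.
- move=> cb; split.
    move=> x xp; split=> [->//|h]; apply/funext => i.
    by have := congr1 (fun f => f (i - 1)) h; rewrite /shiftV subrK.
  have [a [b0 [c [d [[uE vE wE] ab cd]]]]] := case_bP cb.
  (* Under the upward shift the left corner is upper triangular. The reflected right corner is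
     shifted downwards, and its first row contains a subdiagonal entry of [A], which must stay away
     from zero. *)
  have low i : e <= Normc.normc (A i (i - 1)).
    apply: (case_b_lower p1 K0 below pat e0 Ke Uu Vv Ww _ cb).
    by have [] := rowA i.
  have [k2 k20 rc] := @left_corner_down _ _ p1 d c b0 a
    ((fun i => A i (i + 1)) \o -%R) ((fun i => A i i) \o -%R)
    ((fun i => A i (i - 1)) \o -%R) e cd ab e0 (fun i => low (- i)).
  apply: (fsm_applicable_corners p1 (triS 1) _ bd (invertible_op_shift p1 1 iA)
    (k1 := (Normc.normc b0 - Normc.normc a) * (Normc.normc d - Normc.normc c))
    (k2 := k2) (u := u) (v := v) (w := w)) => //.
  + by rewrite mulr_gt0 ?subr_gt0.
  + by rewrite uE vE wE; exact: left_corner_up.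
  + by have [-> -> ->] := factors_rev (And3 uE vE wE).
  + exact: (ell_shift p1 1 bp).
- move=> cc; split.
    move=> x xp; split=> [->//|h]; apply/funext => i.
    by have := congr1 (fun f => f (i + 1)) h; rewrite /shift addrK.
  have [a [b0 [c [d [[uE vE wE] ba dc]]]]] := case_cP cc.
  (* Here the left corner is the one shifted downwards, and the superdiagonal entries must stay away
     from zero. *)
  have low i : e <= Normc.normc (A i (i + 1)).
    apply: (case_c_lower p1 K0 below pat e0 Ke Uu Vv Ww _ cc).
    by have [] := rowA i.
  have [k1 k10 lc] := @left_corner_down _ _ p1 a b0 c d
    (fun i => A i (i - 1)) (fun i => A i i) (fun i => A i (i + 1)) e ba dc e0 low.
  apply: (fsm_applicable_corners p1 (triS (-1)) _ bd (invertible_op_shift p1 (-1) iA)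
    (k2 := (Normc.normc c - Normc.normc d) * (Normc.normc a - Normc.normc b0))
    (k1 := k1) (u := u) (v := v) (w := w)) => //.
  + by rewrite mulr_gt0 ?subr_gt0.
  + by rewrite uE vE wE.
  + have [-> -> ->] := factors_rev (And3 uE vE wE).
    by rewrite opprK; exact: left_corner_up.
  + exact: (ell_shift p1 (-1) bp).
Qed.
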